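(* Let $[\,\cdot\,]$ be the Kauffman–Vogel polynomial specialized to $B=A^{-1}$ and $a=A$. Then for every planar 4-valent graph $G$, $$[G]=2^{c-1}(-A-A^{-1})^{v},$$ where $c$ is the number of connected components of $G$ and $v$ is the number of vertices of $G$.
   Context: A 4-valent rigid vertex embedded graph diagram is a nonempty diagram in the plane of a 4-valent graph embedded in three-space, with finitely many vertices and finitely many crossings (with over/under information). Loops, multiple edges, several components, and components that are closed curves without vertices are allowed; such closed curves count as connected components. A planar 4-valent graph is such a diagram without crossings. Smoothings: at a crossing of an unoriented diagram, orient the two strands locally so that the crossing is positive (standard sign convention). The A-smoothing is the smoothing compatible with these local orientations, and the B-smoothing is the other planar smoothing. (This does not depend on the choice among the two such local orientations.) Dubrovnik polynomial: $D$ is the regular isotopy invariant of unoriented link diagrams in variables $a,z$ determined by: $D_{L}-D_{L'}=z(D_{L_A}-D_{L_B})$, where $L'$ is obtained from $L$ by switching a crossing and $L_A,L_B$ are obtained from $L$ by the A-smoothing and B-smoothing of that crossing; $D$ is multiplied by $a$ (resp. $a^{-1}$) when a positive (resp. negative) curl (kink) is inserted in a strand; $D=1$ on the crossingless unknot. Kauffman–Vogel polynomial: for a 4-valent graph diagram $G$, choose at each vertex one of the two ways to replace it by a crossing. Let $\mathcal{L}$ be the family of link diagrams obtained by replacing each vertex either by the chosen crossing, or by the A-smoothing of the chosen crossing, or by its B-smoothing. Then $$[G]=\sum_{L\in\mathcal{L}}(-A)^{i(L)}(-B)^{j(L)}D_L\Big|_{z=A-B},$$ where $i(L)$ and $j(L)$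 are the numbers of vertices replaced by A-smoothings and B-smoothings respectively. It is known (Kauffman–Vogel) that this does not depend on the choices made and is a regular isotopy invariant of rigid vertex graph diagrams. It satisfies $[\text{crossing}]=A[\text{A-smoothing}]+B[\text{B-smoothing}]+[\text{vertex}]$. *)

(* Defs.v *)
(* World: MathComp. *)
From HB Require Import structures.
From mathcomp Require Import all_boot all_order all_algebra.
Set Implicit Arguments.
Unset Strict Implicit.
Unset Printing Implicit Defensive.
Import GRing.Theory.
Local Open Scope ring_scope.

(* Plane diagrams in Morse position.  A generic diagram is cut by horizontal
   lines into slices; each slice consists of vertical strands and of exactly
   one of: a local minimum, a local maximum, a crossing, a 4-valent vertex.
   A diagram is the word of its slices, read from bottom to top.  Every diagram
   is planar isotopic to one of this form: a crossing or vertex is first turned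
   so that two of its ends point down and two point up.

   In [Cross b] the strand going from bottom left to top right is the
   over-strand when b = true, the under-strand when b = false. *)
Inductive piece := Cup | Cap | Cross of bool | Vertex.

(* (i, x): the piece x, with i strands to its left. *)
Definition slice := (nat * piece)%type.
Definition word := seq slice.

Definition ends_below (x : piece) : nat := if x is Cup then 0 else 2.
Definition ends_above (x : piece) : nat := if x is Cap then 0 else 2.

Definition is_cross (s : slice) : bool := if s.2 is Cross _ then true else false.
Definition is_vertex (s : slice) : bool := if s.2 is Vertex then true else false.

Definition strands_above (n : nat) (s : slice) : nat :=
  (n - ends_below s.2 + ends_above s.2)%N.

Fixpoint well_formed (n : nat) (w : word) : bool :=
  if w is s :: w' then
    (s.1 + ends_below s.2 <= n)%N && well_formed (strands_above n s) w'
  else n == 0%N.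

Definition diagram (w : word) : bool := (0 < size w)%N && well_formed 0 w.
Definition link_diagram (w : word) : bool :=
  diagram w && all (fun s => ~~ is_vertex s) w.
Definition planar (w : word) : bool := all (fun s => ~~ is_cross s) w.

Definition nb_vertices (w : word) : nat := count is_vertex w.

(* Connected components of the graph.  Its points are represented by the
   intersections of the diagram with the horizontal lines between slices:
   a point is a height k <= size w and a position on that line. *)
Definition width (w : word) (k : nat) : nat := foldl strands_above 0%N (take k w).

Definition point (w : word) := {k : 'I_(size w).+1 & 'I_(width w k)}.

(* The ends of the piece of a slice, grouped according to how the piece connects
   them: (false, p) is position p on the line below the slice, (true, p) is
   position p on the line above it.  At a crossing only the two ends of the same
   strand are connected, at a vertex all four ends are. *)
Definition blocks (s : slice) : seq (seq (bool * nat)) :=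
  let: (i, x) := s in
  match x with
  | Cup => [:: [:: (true, i); (true, i.+1)]]
  | Cap => [:: [:: (false, i); (false, i.+1)]]
  | Cross _ => [:: [:: (false, i); (true, i.+1)]; [:: (false, i.+1); (true, i)]]
  | Vertex => [:: [:: (false, i); (false, i.+1); (true, i); (true, i.+1)]]
  end.

Definition linked (s : slice) (x y : bool * nat) : bool :=
  [|| has (fun B => (x \in B) && (y \in B)) (blocks s),
      [&& ~~ x.1, y.1, (x.2 < s.1)%N & y.2 == x.2]
    | [&& ~~ x.1, y.1, (s.1 + ends_below s.2 <= x.2)%N
        & (y.2 + ends_below s.2 == x.2 + ends_above s.2)%N]].

Definition directly_connected (w : word) (x y : point w) : bool :=
  [exists k : 'I_(size w), exists b : bool, exists c : bool,
    [&& (tag x == k + b :> nat)%N, (tag y == k + c :> nat)%N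
      & linked (nth (0%N, Cup) w k)
          (b, nat_of_ord (tagged x)) (c, nat_of_ord (tagged y))]].

Definition adjacent (w : word) : rel (point w) :=
  fun x y => directly_connected x y || directly_connected y x.

Definition nb_components (w : word) : nat := n_comp (@adjacent w) predT.

(* Local moves generating planar isotopy of Morse diagrams (the first five)
   and regular isotopy (all of them, i.e. with the second and third Reidemeister
   moves). *)
Inductive move : word -> word -> Prop :=
| move_far i j x y : (i + ends_below x <= j)%N ->
    (* x and y are far apart; y, at the right of x, is moved from above x
       to below x *)
    move [:: (i, x); ((j - ends_below x + ends_above x)%N, y)]
         [:: (j, y); (i, x)]
| move_zigzag_l i : move [:: (i.+1, Cup); (i, Cap)] [::]
| move_zigzag_r i : move [:: (i, Cup); (i.+1, Cap)] [::]
| move_cross_cup i b :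
    move [:: (i, Cup); (i.+1, Cross b)] [:: (i.+1, Cup); (i, Cross (~~ b))]
| move_cross_cap i b :
    move [:: (i.+1, Cross b); (i, Cap)] [:: (i, Cross (~~ b)); (i.+1, Cap)]
| move_R2 i b : move [:: (i, Cross b); (i, Cross (~~ b))] [::]
| move_R3 i b1 b2 b3 :
    (* the three strands lie one above the other: excluded are the two cases
       where "passes over" is cyclic *)
    (b2 == b1) || (b2 == b3) ->
    move [:: (i, Cross b1); (i.+1, Cross b2); (i, Cross b3)]
         [:: (i.+1, Cross b3); (i, Cross b2); (i.+1, Cross b1)].

Inductive regular_isotopic : word -> word -> Prop :=
| RI_move u v l r : move l r ->
    link_diagram (u ++ l ++ v) -> link_diagram (u ++ r ++ v) ->
    regular_isotopic (u ++ l ++ v) (u ++ r ++ v)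
| RI_refl w : regular_isotopic w w
| RI_sym w1 w2 : regular_isotopic w1 w2 -> regular_isotopic w2 w1
| RI_trans w1 w2 w3 : regular_isotopic w1 w2 -> regular_isotopic w2 w3 ->
    regular_isotopic w1 w3.

(* smoothing b i t is the A-smoothing (t = true) or the B-smoothing (t = false)
   of the crossing (i, Cross b).  With both strands oriented upwards, Cross true
   is positive, and the smoothing compatible with the orientation is the one by
   two vertical strands.  Cross false is positive with one strand upwards and the
   other downwards, and the compatible smoothing is the one by a cap and a cup. *)
Definition smoothing (b : bool) (i : nat) (t : bool) : word :=
  if b == t then [::] else [:: (i, Cap); (i, Cup)].

(* A curl on strand i, with its loop to the right, resp. to the left.  Both
   passages through the crossing go in the same vertical direction, hence the
   curl is positive when b = true and negative when b = false. *)
Definition curl_r (b : bool) (i : nat) : word :=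
  [:: (i.+1, Cup); (i, Cross b); (i.+1, Cap)].
Definition curl_l (b : bool) (i : nat) : word :=
  [:: (i, Cup); (i.+1, Cross b); (i, Cap)].

(* (p, n) represents the Laurent polynomial p(a, z) / (a z)^n, where the inner
   variable of p is a and the outer one is z.  A Laurent polynomial has many
   representations; it is identified by its value at the generic point below. *)
Definition laurent := ({poly {poly int}} * nat)%type.

Definition leval (K : fieldType) (a z : K) (f : laurent) : K :=
  (map_poly (fun q : {poly int} => (map_poly intr q).[a]) f.1).[z]
    / (a * z) ^+ f.2.

Definition var_a : {fraction {poly {poly int}}} :=
  tofrac (('X : {poly int})%:P).
Definition var_z : {fraction {poly {poly int}}} := tofrac ('X : {poly {poly int}}).

Definition lfrac (f : laurent) : {fraction {poly {poly int}}} :=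
  leval var_a var_z f.

(* D assigns to each link diagram its Dubrovnik polynomial; the values of D on
   other words are irrelevant. *)
Record is_dubrovnik (D : word -> laurent) : Prop := IsDubrovnik {
  dubrovnik_isotopy w1 w2 : link_diagram w1 -> link_diagram w2 ->
    regular_isotopic w1 w2 -> lfrac (D w1) = lfrac (D w2);
  dubrovnik_skein u v i b : link_diagram (u ++ (i, Cross b) :: v) ->
    lfrac (D (u ++ (i, Cross b) :: v)) - lfrac (D (u ++ (i, Cross (~~ b)) :: v))
    = var_z * (lfrac (D (u ++ smoothing b i true ++ v))
               - lfrac (D (u ++ smoothing b i false ++ v)));
  dubrovnik_curl_r u v i b :
    link_diagram (u ++ v) -> link_diagram (u ++ curl_r b i ++ v) ->
    lfrac (D (u ++ curl_r b i ++ v))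
    = (if b then var_a else var_a^-1) * lfrac (D (u ++ v));
  dubrovnik_curl_l u v i b :
    link_diagram (u ++ v) -> link_diagram (u ++ curl_l b i ++ v) ->
    lfrac (D (u ++ curl_l b i ++ v))
    = (if b then var_a else var_a^-1) * lfrac (D (u ++ v));
  dubrovnik_unknot : lfrac (D [:: (0%N, Cup); (0%N, Cap)]) = 1
}.

(* The k-th vertex from the bottom is replaced by the crossing Cross b, where b is
   the k-th entry of eps, or by a smoothing of that crossing, according to the
   k-th entry of s: None for the crossing, Some true for its A-smoothing, Some
   false for its B-smoothing. *)
Fixpoint resolve (eps : seq bool) (s : seq (option bool)) (w : word) : word :=
  match w with
  | [::] => [::]
  | (i, Vertex) :: w' =>
      (if head None s is Some t then smoothing (head true eps) i t
       else [:: (i, Cross (head true eps))])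
        ++ resolve (behead eps) (behead s) w'
  | x :: w' => x :: resolve eps s w'
  end.

(* The Kauffman-Vogel polynomial of G, evaluated at a, A, B; eps is the choice of
   a crossing at each vertex. *)
Definition kauffman_vogel (K : fieldType) (D : word -> laurent) (G : word)
    (eps : (nb_vertices G).-tuple bool) (a A B : K) : K :=
  \sum_(s : (nb_vertices G).-tuple (option bool))
    (- A) ^+ count_mem (Some true) s * (- B) ^+ count_mem (Some false) s
      * leval a (A - B) (D (resolve eps s G)).

(* Main.v *)
From HB Require Import structures.
Require Import Defs.
From mathcomp Require Import all_boot all_order all_algebra.
From mathcomp Require Import zify ring.
Set Implicit Arguments.
Unset Strict Implicit.
Unset Printing Implicit Defensive.
Import GRing.Theory.
Local Open Scope ring_scope.

(** At [a = A] and [z = A - A^-1], twice the Dubrovnik polynomial of a link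
    diagram is the sum of [A ^ writhe] over its orientations.  This sum, a
    transfer matrix on the words of slices, satisfies the same axioms, so it is
    enough that these determine the polynomial.  For that, cut a diagram along a
    horizontal line: modulo the skein relation its lower half may be replaced by
    a union of arcs each of which passes over all the previous ones, and the span
    of these standard tangles is stable under adding one more slice.

    Expanding a vertex into its crossing and two smoothings then leaves
    [- A - A^-1] times the orientations that alternate (in, out, in, out) around
    the vertex.  In a planar graph, reversing every second strand of each
    horizontal line turns the alternating orientations into the two-colourings of
    the connected components, of which there are [2 ^ c]. *)

(** * Uniqueness of the Dubrovnik polynomial *)

Fixpoint tangle (n : nat) (w : word) (m : nat) : bool :=
  if w is s :: w' then
    [&& ~~ is_vertex s, (s.1 + ends_below s.2 <= n)%N
      & tangle (strands_above n s) w' m]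
  else n == m.

Lemma tangle_cat n u k v m :
  tangle n u k -> tangle n (u ++ v) m = tangle k v m.
Proof.
elim: u n => [|s u IH] n /=; first by move/eqP->.
by case/and3P=> -> -> /IH ->.
Qed.

Lemma tangle_catP n u v m :
  reflect (exists2 k, tangle n u k & tangle k v m) (tangle n (u ++ v) m).
Proof.
apply: (iffP idP) => [|[k nuk kvm]]; last by rewrite (tangle_cat _ _ nuk).
elim: u n => [|s u IH] n /=; first by exists n; rewrite ?eqxx.
by case/and3P=> -> -> /IH.
Qed.

Lemma link_diagram_tangle w : link_diagram w = (0 < size w)%N && tangle 0 w 0.
Proof.
rewrite /link_diagram /diagram -andbA; congr (_ && _).
suff E n : well_formed n w && all (fun s => ~~ is_vertex s) w = tangle n w 0.
  exact: E.
elim: w n => [|s w IH] n /=; first by rewrite andbT.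
by rewrite -IH; case: (~~ _); rewrite ?andbF //= andbA.
Qed.

Ltac tangle_tac :=
  rewrite /= ?eqxx /strands_above /is_vertex /=; try by [lia | move=> *; lia].

Ltac tangle_by H :=
  rewrite /= /strands_above /is_vertex /=; repeat (apply/andP; split); try lia;
  match type of H with is_true (tangle ?n _ _) =>
    match goal with |- is_true (tangle ?a _ _) =>
      replace a with n by lia; exact: H
    end
  end.

(* The strand with top ends [j] and [j + d + 1] above [j + d] strands: it passes
   over the last [d] of them. *)
Fixpoint arc (j d : nat) : word :=
  if d is d'.+1 then arc j.+1 d' ++ [:: (j, Cross true)]
  else [:: (j, Cup)].

Lemma tangle_arc n j d : (j + d <= n)%N -> tangle n (arc j d) n.+2.
Proof.
elim: d n j => [|d IH] n j le; first by tangle_tac.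
rewrite /= (@tangle_cat _ _ n.+2); first by tangle_tac.
by apply: IH; lia.
Qed.

Lemma tangle_arc_cat n j d v m : (j + d <= n)%N ->
  tangle n (arc j d ++ v) m = tangle n.+2 v m.
Proof. by move=> E; apply/tangle_cat/tangle_arc. Qed.

Fixpoint descent (j m : nat) : word :=
  if m is m'.+1 then descent j.+1 m' ++ [:: (j, Cross true)] else [::].

Lemma arc_descent j m d : arc j (m + d) = arc (j + m) d ++ descent j m.
Proof.
elim: m j => [|m IH] j /=; first by rewrite addn0 cats0.
by rewrite IH addSnnS catA.
Qed.

Inductive standard : nat -> word -> Prop :=
| standard_nil : standard 0 [::]
| standard_arc n j d b :
    n = (j + d)%N -> standard n b -> standard n.+2 (b ++ arc j d).

Lemma standard_tangle n b : standard n b -> tangle 0 b n.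
Proof.
elim=> // m j d b' E _ IH.
by apply/tangle_catP; exists m => //; apply: tangle_arc; rewrite E.
Qed.

Section Uniqueness.

Variables (K : fieldType) (z : K) (g : word -> K).
Hypothesis z_neq0 : z != 0.
Hypothesis g_move : forall u v l r, move l r ->
  tangle 0 (u ++ l ++ v) 0 -> tangle 0 (u ++ r ++ v) 0 ->
  g (u ++ l ++ v) = g (u ++ r ++ v).
Hypothesis g_skein : forall u v i b, tangle 0 (u ++ (i, Cross b) :: v) 0 ->
  g (u ++ (i, Cross b) :: v) - g (u ++ (i, Cross (~~ b)) :: v)
  = z * (g (u ++ smoothing b i true ++ v) - g (u ++ smoothing b i false ++ v)).
Hypothesis g_curl_r : forall u v i b,
  tangle 0 (u ++ v) 0 -> tangle 0 (u ++ curl_r b i ++ v) 0 ->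
  g (u ++ v) = 0 -> g (u ++ curl_r b i ++ v) = 0.
Hypothesis g_curl_l : forall u v i b,
  tangle 0 (u ++ v) 0 -> tangle 0 (u ++ curl_l b i ++ v) 0 ->
  g (u ++ v) = 0 -> g (u ++ curl_l b i ++ v) = 0.
Hypothesis g_circle : forall v,
  tangle 0 v 0 -> g v = 0 -> g ((0%N, Cup) :: (0%N, Cap) :: v) = 0.
Hypothesis g_nil : g [::] = 0.

Definition eqv (n : nat) (l r : word) (m : nat) : Prop :=
  [/\ tangle n l m, tangle n r m & forall u v, tangle 0 u n -> tangle m v 0 ->
      g (u ++ l ++ v) = g (u ++ r ++ v)].

Lemma eqv_move n l r m : move l r -> tangle n l m -> tangle n r m -> eqv n l r m.
Proof.
move=> lr nlm nrm; split=> // u v Hu Hv; apply: g_move => //.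
  by rewrite (tangle_cat _ _ Hu) (tangle_cat _ _ nlm).
by rewrite (tangle_cat _ _ Hu) (tangle_cat _ _ nrm).
Qed.

Lemma eqv_refl n w m : tangle n w m -> eqv n w w m.
Proof. by split. Qed.

Lemma eqv_sym n l r m : eqv n l r m -> eqv n r l m.
Proof. by case=> H1 H2 H; split=> // u v Hu Hv; rewrite H. Qed.

Lemma eqv_trans n y x w m : eqv n x y m -> eqv n y w m -> eqv n x w m.
Proof.
by case=> H1 H2 H [H1' H2' H']; split=> // u v Hu Hv; rewrite H // H'.
Qed.

Lemma eqv_cat n l r k l' r' m :
  eqv n l r k -> eqv k l' r' m -> eqv n (l ++ l') (r ++ r') m.
Proof.
move=> [H1 H2 H] [H1' H2' H']; split.
- by rewrite (tangle_cat _ _ H1).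
- by rewrite (tangle_cat _ _ H2).
move=> u v Hu Hv; rewrite -!catA H //; last by rewrite (tangle_cat _ _ H1').
by rewrite !(catA u) H' // (tangle_cat _ _ Hu).
Qed.

Lemma eqv_catl k n u l r m :
  tangle n u k -> eqv k l r m -> eqv n (u ++ l) (u ++ r) m.
Proof. by move=> /eqv_refl; apply: eqv_cat. Qed.

Lemma eqv_catr k n l r v m :
  eqv n l r k -> tangle k v m -> eqv n (l ++ v) (r ++ v) m.
Proof. by move=> H /eqv_refl; apply: eqv_cat. Qed.

Lemma eqv_far n i x j y k m : k = (j - ends_below x + ends_above x)%N ->
  tangle n [:: (i, x); (k, y)] m -> (i + ends_below x <= j)%N ->
  eqv n [:: (i, x); (k, y)] [:: (j, y); (i, x)] m.
Proof.
move=> -> H le; apply: eqv_move => //; first exact: move_far.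
move: H le; case: x => [||?|]; case: y => [||?|]; tangle_tac.
Qed.

Lemma eqv_cross_cup n k b b' : b' = ~~ b -> (k < n)%N ->
  eqv n [:: (k, Cup); (k.+1, Cross b)] [:: (k.+1, Cup); (k, Cross b')] n.+2.
Proof.
by move=> -> lt; apply: eqv_move; [apply: move_cross_cup|tangle_tac|tangle_tac].
Qed.

Lemma eqv_cross_cap n k b b' : b' = ~~ b -> (k < n)%N ->
  eqv n.+2 [:: (k.+1, Cross b); (k, Cap)] [:: (k, Cross b'); (k.+1, Cap)] n.
Proof.
by move=> -> lt; apply: eqv_move; [apply: move_cross_cap|tangle_tac|tangle_tac].
Qed.

Lemma eqv_R2 n k b b' : b' = ~~ b -> (k.+1 < n)%N ->
  eqv n [:: (k, Cross b); (k, Cross b')] [::] n.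
Proof.
by move=> -> lt; apply: eqv_move; [apply: move_R2|tangle_tac|tangle_tac].
Qed.

Lemma eqv_zigzag_l n k : (k < n)%N -> eqv n [:: (k.+1, Cup); (k, Cap)] [::] n.
Proof.
by move=> lt; apply: eqv_move; [apply: move_zigzag_l|tangle_tac|tangle_tac].
Qed.

Lemma eqv_zigzag_r n k : (k < n)%N -> eqv n [:: (k, Cup); (k.+1, Cap)] [::] n.
Proof.
by move=> lt; apply: eqv_move; [apply: move_zigzag_r|tangle_tac|tangle_tac].
Qed.

Lemma eqv_cup_pass n k : (k < n)%N ->
  eqv n [:: (k, Cup); (k.+1, Cross true); (k, Cross true)] [:: (k.+1, Cup)] n.+2.
Proof.
move=> lt.
apply: (@eqv_trans _ [:: (k.+1, Cup); (k, Cross false); (k, Cross true)]).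
  apply: (@eqv_catr n.+2 _ [:: _; _] [:: _; _]); last by tangle_tac.
  exact: eqv_cross_cup.
apply: (@eqv_catl n.+2 n [:: _] _ [::]); first by tangle_tac.
by apply: eqv_R2; lia.
Qed.

Lemma eqv_cap_pass n k : (k < n)%N ->
  eqv n.+2 [:: (k.+1, Cross true); (k, Cross true); (k.+1, Cap)] [:: (k, Cap)] n.
Proof.
move=> lt.
apply: (@eqv_trans _ [:: (k.+1, Cross true); (k.+1, Cross false); (k, Cap)]).
  apply: (@eqv_catl n.+2 _ [:: _]); first by tangle_tac.
  exact/eqv_sym/eqv_cross_cap.
apply: (@eqv_catr n.+2 _ [:: _; _] [::]); last by tangle_tac.
by apply: eqv_R2; lia.
Qed.

Lemma eqv_cross_pass n k c : (k.+2 < n)%N ->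
  eqv n [:: (k.+1, Cross true); (k, Cross true); (k.+1, Cross c)]
    [:: (k, Cross c); (k.+1, Cross true); (k, Cross true)] n.
Proof.
move=> lt; apply: eqv_sym.
by apply: eqv_move; [apply: move_R3; case: c | tangle_tac | tangle_tac].
Qed.

Lemma eqv_slide_left n m j j' d k s : ~~ is_vertex (k, s) ->
  (k + ends_below s <= j)%N -> n = (j + d)%N ->
  j' = (j - ends_below s + ends_above s)%N ->
  m = (n - ends_below s + ends_above s).+2 ->
  eqv n (arc j d ++ [:: (k, s)]) ((k, s) :: arc j' d) m.
Proof.
move=> vs le -> -> -> {n m j'}.
elim: d j le => [|d IH] j le /=.
  by apply/eqv_sym/eqv_far => //; move: vs le; case: s => [||?|]; tangle_tac.
rewrite -!catA; set j' := (j - _ + _)%N.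
apply: (@eqv_trans _ (arc j.+1 d ++ [:: (k, s); (j', Cross true)])).
  apply: (@eqv_catl (j + d.+1).+2); first by apply: tangle_arc; lia.
  by apply/eqv_sym/eqv_far => //; move: vs le; rewrite /j';
    case: s {IH} @j' => [||?|]; tangle_tac.
have := @eqv_catr _ _ _ _ [:: (j', Cross true)]
   (j + d.+1 - ends_below s + ends_above s).+2 (IH j.+1 _).
rewrite -catA addSnnS; have -> : (j.+1 - ends_below s + ends_above s = j'.+1)%N by lia.
apply; first by lia.
by move: vs le; rewrite /j'; case: s {IH} @j' => [||?|]; tangle_tac.
Qed.

Lemma eqv_slide_over n m j d d' k s : ~~ is_vertex (k, s) ->
  (j <= k)%N -> (k + ends_below s <= n)%N -> n = (j + d)%N ->
  d' = (d - ends_below s + ends_above s)%N ->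
  m = (n - ends_below s + ends_above s).+2 ->
  eqv n (arc j d ++ [:: (k.+1, s)]) ((k, s) :: arc j d') m.
Proof.
move=> vs jk kd nE dE mE;
  elim: d n m j d' jk kd nE dE mE => [|d IH] n m j d' jk kd nE dE mE.
  have {jk kd} [sE kE] : s = Cup /\ k = j.
    by move: vs jk kd; case: s {dE mE} => [||?|] //= *; split=> //; lia.
  have -> : d' = 2%N by rewrite dE sE.
  rewrite sE kE; apply: eqv_sym.
  apply: (@eqv_trans _ ([:: (j, Cup); (j, Cup)] ++ [:: (j.+1, Cross true);
    (j, Cross true)])).
    rewrite sE /= in mE; apply: (@eqv_catr (j + 4) _ [:: _; _]); last by tangle_tac.
    by apply: eqv_far; tangle_tac.
  apply: (@eqv_catl j.+2 _ [:: _] (_ :: _)); first by tangle_tac.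
  have -> : m = j.+4 by rewrite mE sE /=; lia.
  by apply: eqv_cup_pass; lia.
have Ha : tangle n (arc j.+1 d) n.+2 by apply: tangle_arc; lia.
case: (ltnP j k) => [lt|le].
  have [e d'E] : exists e, d' = e.+1.
    by exists d'.-1; move: vs kd; case: s {IH mE} dE => [||?|]; tangle_tac.
  rewrite d'E /= -catA /=.
  apply: (@eqv_trans _ (arc j.+1 d ++ [:: (k.+1, s); (j, Cross true)])).
    apply: (eqv_catl Ha); apply: eqv_far; tangle_tac.
    by move: vs kd mE; case: s {IH dE} => [||?|]; tangle_tac.
  have := @eqv_catr m n _ _ [:: (j, Cross true)] m (IH n m j.+1 e lt kd _ _ mE).
  rewrite -catA; apply; try lia.
  by move: vs kd mE; case: s {IH dE} => [||?|]; tangle_tac.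
have {le jk} kj : k = j by lia.
subst k => {IH}.
move: vs kd dE mE; case: s => [||c|] // _ /= kd dE mE.
- have -> : d' = d.+3 by lia.
  rewrite /= -!catA /=.
  apply: (@eqv_trans _ ((arc j.+1 d ++ [:: (j, Cup)]) ++ [:: (j.+2, Cross true);
    (j.+1, Cross true); (j, Cross true)])).
    rewrite -catA; apply: (eqv_catl Ha); apply: eqv_sym.
    apply: (@eqv_trans _ ([:: (j, Cross true); (j, Cup)] ++ [:: (j.+1, Cross true);
      (j, Cross true)])).
      apply: (@eqv_catr n.+4 _ [:: _; _] [:: _; _]); last by tangle_tac.
      by apply: eqv_far; tangle_tac.
    apply: (@eqv_catl n.+2 _ [:: _] (_ :: _)); first by tangle_tac.
    have -> : m = n.+4 by lia.
    by apply: eqv_cup_pass; lia.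
  apply: (@eqv_catr n.+4 _ _ (_ :: _)); last by tangle_tac.
  by apply: eqv_slide_left; rewrite /=; lia.
- case: d nE Ha dE => [|d] nE Ha dE; first by lia.
  have -> : d' = d by lia.
  rewrite /= -!catA /=.
  apply: (@eqv_trans _ (arc j.+2 d ++ [:: (j, Cap)])).
    apply: (@eqv_catl n.+2); first by apply: tangle_arc; lia.
    have -> : m = n by lia.
    by apply: eqv_cap_pass; lia.
  by apply: eqv_slide_left; rewrite /=; lia.
- case: d nE Ha dE => [|d] nE Ha dE; first by lia.
  have -> : d' = d.+2 by lia.
  rewrite /= -!catA /=.
  apply: (@eqv_trans _ ((arc j.+2 d ++ [:: (j, Cross c)]) ++ [:: (j.+1, Cross true);
    (j, Cross true)])).
    rewrite -catA.
    apply: (@eqv_catl n.+2); first by apply: tangle_arc; lia.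
    have -> : m = n.+2 by lia.
    by apply: eqv_cross_pass; lia.
  apply: (@eqv_catr n.+2 _ _ (_ :: _)); last by tangle_tac.
  by apply: eqv_slide_left; rewrite /=; lia.
Qed.

Lemma curl_cup u n k c v : tangle 0 u n -> (k <= n)%N -> tangle n.+2 v 0 ->
  g (u ++ (k, Cup) :: v) = 0 -> g (u ++ (k, Cup) :: (k, Cross c) :: v) = 0.
Proof.
move=> Hu le Hv gz.
have [_ _] : eqv n [:: (k, Cup); (k, Cross c)] ((k, Cup) :: curl_l (~~ c) k) n.+2.
  apply/eqv_sym/(@eqv_trans _ [:: (k, Cup); (k.+2, Cup); (k, Cross c); (k.+1, Cap)]).
    apply: (@eqv_cat _ [:: _; _] [:: _; _] n.+4).
      by apply/eqv_sym/eqv_far; tangle_tac.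
    by apply: eqv_cross_cap; rewrite ?negbK; lia.
  apply: (@eqv_catl n.+2 _ [:: _] [:: _; _; _] [:: _]); first by tangle_tac.
  apply: (@eqv_trans _ [:: (k, Cross c); (k.+2, Cup); (k.+1, Cap)]).
    apply: (@eqv_catr n.+4 _ [:: _; _] [:: _; _]); last by tangle_tac.
    by apply/eqv_sym/eqv_far; tangle_tac.
  apply: (@eqv_catl n.+2 _ [:: _] _ [::]); first by tangle_tac.
  by apply: eqv_zigzag_l; lia.
move=> /(_ u v Hu Hv) /= ->; rewrite -cat1s catA; apply: g_curl_l; rewrite -catA //=.
  by rewrite (tangle_cat _ _ Hu); tangle_by Hv.
by rewrite (tangle_cat _ _ Hu); tangle_by Hv.
Qed.

Lemma curl_cap u n k c v : tangle 0 u n.+2 -> (k <= n)%N -> tangle n v 0 ->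
  g (u ++ (k, Cap) :: v) = 0 -> g (u ++ (k, Cross c) :: (k, Cap) :: v) = 0.
Proof.
move=> Hu le Hv gz.
have [_ _] : eqv n.+2 [:: (k, Cross c); (k, Cap)] (curl_l (~~ c) k ++ [:: (k, Cap)]) n.
  apply/eqv_sym/(@eqv_trans _ [:: (k, Cup); (k.+1, Cross (~~ c)); (k.+2, Cap);
    (k, Cap)]).
    apply: (@eqv_catl n.+4 _ [:: _; _]); first by tangle_tac.
    by apply: eqv_far; tangle_tac.
  apply: (@eqv_trans _ [:: (k, Cup); (k.+2, Cross c); (k.+1, Cap); (k, Cap)]).
    apply: (@eqv_catl n.+4 _ [:: _] [:: _; _; _] [:: _; _; _]); first by tangle_tac.
    apply: (@eqv_catr n.+2 _ [:: _; _] [:: _; _]); last by tangle_tac.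
    by apply/eqv_sym/eqv_cross_cap; lia.
  apply: (@eqv_trans _ [:: (k, Cross c); (k, Cup); (k.+1, Cap); (k, Cap)]).
    apply: (@eqv_catr n.+4 _ [:: _; _] [:: _; _]); last by tangle_tac.
    by apply: eqv_far; tangle_tac.
  apply: (@eqv_catl n.+2 _ [:: _] [:: _; _; _] [:: _]); first by tangle_tac.
  apply: (@eqv_catr n.+2 _ [:: _; _] [::]); last by tangle_tac.
  by apply: eqv_zigzag_r; lia.
move=> /(_ u v Hu Hv) /= ->; apply: g_curl_l => //=.
  by rewrite (tangle_cat _ _ Hu); tangle_by Hv.
by rewrite (tangle_cat _ _ Hu); tangle_by Hv.
Qed.

(* The two curls of opposite sign on the strand at the left of the circle have
   the circle and, up to isotopy, the bare strand as their smoothings. *)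
Lemma circle_zero u n v : tangle 0 u n.+1 -> tangle n.+1 v 0 ->
  g (u ++ v) = 0 -> g (u ++ (n.+1, Cup) :: (n.+1, Cap) :: v) = 0.
Proof.
move=> Hu Hv gz.
have Hc b : g (u ++ curl_r b n ++ v) = 0.
  by apply: g_curl_r; rewrite // (tangle_cat _ _ Hu) //; tangle_by Hv.
have Hu' : tangle 0 (u ++ [:: (n.+1, Cup)]) n.+3.
  by rewrite (tangle_cat _ _ Hu); tangle_tac.
have [_ _ /(_ u v Hu Hv)] : eqv n.+1
    [:: (n.+1, Cup); (n, Cap); (n, Cup); (n.+1, Cap)] [::] n.+1.
  apply: (@eqv_trans _ [:: (n, Cup); (n.+1, Cap)]); last exact: eqv_zigzag_r.
  apply: (@eqv_catr n.+1 _ [:: _; _] [::]); last by tangle_tac.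
  exact: eqv_zigzag_l.
rewrite /= gz => gz'.
have := @g_skein (u ++ [:: (n.+1, Cup)]) ((n.+1, Cap) :: v) n true.
rewrite /smoothing /= -!catA /= gz' !(Hc true, Hc false) => /(_ _).
rewrite !subr0 => /(_ _) H;
  have /eqP : 0 = z * g (u ++ [:: (n.+1, Cup), (n.+1, Cap) & v]).
  by apply: H; rewrite (tangle_cat _ _ Hu); tangle_by Hv.
by rewrite eq_sym mulf_eq0 (negbTE z_neq0) => /eqP.
Qed.

Definition kills (n : nat) (v : word) : Prop :=
  tangle n v 0 /\ forall b, standard n b -> g (b ++ v) = 0.

Lemma kills_arc n j d v : n = (j + d)%N -> kills n.+2 v -> kills n (arc j d ++ v).
Proof.
move=> E [Hv gz]; split=> [|b sb]; first by rewrite tangle_arc_cat // E.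
by rewrite catA gz //; apply: standard_arc.
Qed.

Lemma kills_arcs n v :
  (forall j d, n = (j + d)%N -> kills n (arc j d ++ v)) -> kills n.+2 v.
Proof.
move=> H; split.
  have [] := H n 0%N (esym (addn0 n)).
  by rewrite tangle_arc_cat ?addn0.
move=> b; move nE: n.+2 => n2 sb; case: sb nE => // n' j d b' E sb' [nE].
by rewrite -catA; rewrite -nE in E sb'; have [_ ->] := H j d E.
Qed.

Lemma kills_eqv n l r m v :
  eqv n l r m -> tangle m v 0 -> kills n (r ++ v) -> kills n (l ++ v).
Proof.
move=> [nlm nrm E] Hv [Hrv gz]; split; first by rewrite (tangle_cat _ _ nlm).
by move=> b sb; rewrite E ?gz //; apply: standard_tangle.
Qed.

Lemma kills_slide_left n j d k s v : ~~ is_vertex (k, s) ->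
  (k + ends_below s <= j)%N -> n = (j + d)%N ->
  tangle (n.+2 - ends_below s + ends_above s) v 0 ->
  kills n ((k, s) :: arc (j - ends_below s + ends_above s) d ++ v) ->
  kills n (arc j d ++ (k, s) :: v).
Proof.
move=> vs le nE Hv kv; rewrite -cat1s catA; rewrite -cat_cons in kv.
apply: (kills_eqv _ Hv kv).
by apply: eqv_slide_left => //; lia.
Qed.

Lemma kills_slide_over n j d k s v : ~~ is_vertex (k, s) ->
  (j < k)%N -> (k + ends_below s <= n.+1)%N -> n = (j + d)%N ->
  tangle (n.+2 - ends_below s + ends_above s) v 0 ->
  kills n ((k.-1, s) :: arc j (d - ends_below s + ends_above s) ++ v) ->
  kills n (arc j d ++ (k, s) :: v).
Proof.
case: k => // k vs lt le nE Hv kv; rewrite -cat1s catA; rewrite -cat_cons in kv.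
apply: (kills_eqv _ Hv kv).
by apply: eqv_slide_over => //; lia.
Qed.

Lemma kills1 v : tangle 1 v 0 -> kills 1 v.
Proof.
by move=> Hv; split=> // b; move E: 1%N => n sb; case: sb E.
Qed.

Lemma kills_cup n k v : (k <= n)%N -> kills n.+2 v -> kills n ((k, Cup) :: v).
Proof.
elim/ltn_ind: n k v => n IH k v; rewrite leq_eqVlt.
case: eqP => [-> _ kv|_ /= lt kv]; first exact: kills_arc (esym (addn0 n)) kv.
have [Hv _] := kv; case: n lt kv Hv IH => [|[|n]] // lt kv Hv IH.
  by apply: kills1; tangle_by Hv.
apply: kills_arcs => j d nE; case: (leqP k j) => kj.
  apply: kills_slide_left; rewrite //= ?addn0 //; first by tangle_by Hv.
  by apply: IH => //; [lia | apply: kills_arc; [lia | ]].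
apply: kills_slide_over; rewrite //= ?addn0 //; first by tangle_by Hv.
by apply: IH => //; [lia | apply: kills_arc; [lia | ]].
Qed.

Definition cross_stable (n : nat) : Prop :=
  forall k c v, (k.+1 < n)%N -> kills n v -> kills n ((k, Cross c) :: v).

Definition cap_stable (n : nat) : Prop :=
  forall k v, (k <= n)%N -> kills n v -> kills n.+2 ((k, Cap) :: v).

Lemma kills_hook n k d v : cross_stable n ->
  n = (k.+1 + d)%N -> kills n v -> kills n (arc k.+1 d ++ (k, Cap) :: v).
Proof.
move=> cn; elim: d k => [|d IH] k nE kv; have [Hv _] := kv.
  by apply: (@kills_eqv _ [:: _; _] [::] n) => //; apply: eqv_zigzag_l; lia.
rewrite /= -catA /=.
suff E : eqv n (arc k.+2 d ++ [:: (k.+1, Cross true); (k, Cap)])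
    ((k, Cross false) :: arc k.+2 d ++ [:: (k.+1, Cap)]) n.
  have := kills_eqv E Hv; rewrite -!catA /=; apply.
  rewrite -catA; apply: cn; [lia | apply: IH => //; lia].
have Ha : tangle n (arc k.+2 d) n.+2 by apply: tangle_arc; lia.
apply: (@eqv_trans _ (arc k.+2 d ++ [:: (k, Cross false); (k.+1, Cap)])).
  by apply: (eqv_catl Ha); apply: eqv_cross_cap; lia.
rewrite -cat1s catA -cat_cons.
apply: (@eqv_catr n.+2); last by tangle_tac.
by apply: eqv_slide_left; rewrite //=; lia.
Qed.

Lemma kills_cap_right n j d v : cross_stable n ->
  n = (j + d).+1 -> kills n v -> kills n (arc j d.+1 ++ (n, Cap) :: v).
Proof.
move=> cn; elim: d j v => [|d IH] j v nE kv; have [Hv gz] := kv.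
  rewrite addn0 in nE; rewrite nE; rewrite nE in Hv gz.
  have Hc : tangle j.+1 (curl_r true j ++ v) 0 by tangle_by Hv.
  split=> // b sb; have Hb := standard_tangle sb; apply: g_curl_r; last exact: gz.
    by rewrite (tangle_cat _ _ Hb).
  by rewrite (tangle_cat _ _ Hb).
have -> : arc j d.+2 = arc j.+1 d.+1 ++ [:: (j, Cross true)] by [].
have := IH j.+1 ((j, Cross true) :: v); have := @tangle_arc n j.+1 d.+1.
move: (arc _ _) => a Ha {}IH; rewrite -catA /=.
suff E : eqv n (a ++ [:: (j, Cross true); (n, Cap)])
    (a ++ [:: (n, Cap); (j, Cross true)]) n.
  have := kills_eqv E Hv; rewrite -!catA; apply.
  by apply: IH; [lia | apply: cn; [lia |]].
apply: (@eqv_catl n.+2); first by apply: Ha; lia.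
by apply: eqv_far; rewrite /=; tangle_tac.
Qed.

Lemma kills_cap_left n j d v : cross_stable n ->
  n = (j + d)%N -> kills n v -> kills n (arc j d ++ (j, Cap) :: v).
Proof.
move=> cn; case: d => [|d] nE kv; have [Hv gz] := kv.
  rewrite addn0 in nE; rewrite -nE {j nE}; split=> [|b sb] /=; first by tangle_by Hv.
  case: n cn kv Hv gz sb => [|n] cn kv Hv gz sb; last first.
    by apply: circle_zero (gz _ sb) => //; apply: standard_tangle.
  move: (gz _ sb); move nE: 0%N sb => m sb; case: sb nE => // _.
  exact: g_circle.
have [Hk kz] : kills n (arc j.+1 d ++ (j, Cap) :: v) by apply: kills_hook => //; lia.
split=> [|b sb]; first by rewrite tangle_arc_cat; [tangle_by Hv | lia].
rewrite /= -catA catA; apply: (curl_cap (n := n)) => //; [|lia|by rewrite -catA kz].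
rewrite (tangle_cat _ _ (standard_tangle sb)).
by apply: tangle_arc; lia.
Qed.

Lemma cap_stable_step n : cross_stable n ->
  (forall m, n = m.+2 -> cap_stable m) -> cap_stable n.
Proof.
move=> cn capm k v kn kv; have [Hv _] := kv.
apply: kills_arcs => j d nE.
case: (ltngtP k j) => [kj|jk|->]; last exact: kills_cap_left.
- case: (ltnP k.+1 j) => [kj'|jk'].
    apply: kills_slide_left => //=; [by rewrite addn2 | by tangle_by Hv |].
    have [m mE] : exists m, n = m.+2 by exists n.-2; lia.
    rewrite {1}mE; apply: capm => //; first by lia.
    by apply: kills_arc; [lia | rewrite -mE].
  have jE : j = k.+1 by lia.
  by rewrite jE; apply: kills_hook => //; rewrite -jE.
case: (ltnP k n) => [kn'|nk].
  apply: kills_slide_over => //=; [by rewrite addn2 | by tangle_by Hv |].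
  have [m mE] : exists m, n = m.+2 by exists n.-2; lia.
  rewrite {1}mE; apply: capm => //; first by lia.
  by apply: kills_arc; [lia | rewrite -mE].
have kE : k = n by lia.
case: d nE => [|d] nE; first by lia.
by rewrite kE; apply: kills_cap_right => //; lia.
Qed.

(* The two smoothings are already under control, so the sign of the crossing may
   be chosen freely for each arc. *)
Lemma kills_cross n k c v : cap_stable n -> (k <= n)%N -> kills n.+2 v ->
  (forall j d, n = (j + d)%N ->
     exists c', kills n (arc j d ++ (k, Cross c') :: v)) ->
  kills n.+2 ((k, Cross c) :: v).
Proof.
move=> capn kn kv H; have [Hv vz] := kv.
have [_ wz] : kills n.+2 ((k, Cap) :: (k, Cup) :: v).
  by apply: capn => //; apply: kills_cup.
have flip b c' : standard n.+2 b -> g (b ++ (k, Cross c') :: v) = 0 ->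
    g (b ++ (k, Cross (~~ c')) :: v) = 0.
  move=> sb gz; have := @g_skein b v k c'; rewrite gz sub0r /smoothing => E.
  apply/eqP; rewrite -oppr_eq0 E.
    by case: (c') => /=; rewrite vz // wz // subrr mulr0.
  by rewrite (tangle_cat _ _ (standard_tangle sb)); tangle_by Hv.
split=> [|b]; first by tangle_by Hv.
move nE: n.+2 => n2 sb; case: sb nE => // n' j d b' E sb' [nE].
rewrite -nE in E sb'; have [c' [_ /(_ b' sb')]] := H j d E.
have sb := standard_arc E sb'; rewrite catA.
case: (eqVneq c c') => [-> //|cc' gz].
have -> : c = ~~ c' by case: (c) (c') cc' => [] [].
exact: flip.
Qed.

Lemma kills_cross_below n k c v : cross_stable n -> cap_stable n ->
  (k < n)%N -> kills n.+2 v -> kills n.+2 ((k, Cross c) :: v).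
Proof.
move=> cn capn kn kv; have [Hv _] := kv.
apply: kills_cross => // [|j d nE]; first exact: ltnW.
case: (ltngtP k.+1 j) => [kj|jk|jE].
- exists true; apply: kills_slide_left => //=; [by rewrite addn2|by tangle_by Hv|].
  by apply: cn; [lia | apply: kills_arc; [lia|]].
- case: (ltnP j k) => [jk'|kj].
    exists true; apply: kills_slide_over => //=; [by rewrite addn2;
      lia|by tangle_by Hv|].
    by apply: cn; [lia | apply: kills_arc; [lia|]].
  have -> : j = k by lia.
  case: d nE => [|d] nE; first by lia.
  exists false; rewrite /= -catA /=.
  have E : eqv n (arc k.+1 d ++ [:: (k, Cross true);
    (k, Cross false)]) (arc k.+1 d) n.+2.
    rewrite -[X in eqv _ _ X]cats0; apply: (@eqv_catl n.+2).
      by apply: tangle_arc; lia.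
    by apply: eqv_R2; lia.
  by have := kills_eqv E Hv; rewrite -catA; apply; apply: kills_arc => //; lia.
exists true; rewrite -jE -cat1s catA.
by apply: (@kills_arc n k d.+1) => //; lia.
Qed.

Lemma eqv_arc_cross_right n j d : n = (j + d).+1 ->
  eqv n (arc j d.+1 ++ [:: (n, Cross true)]) (arc j d) n.+2.
Proof.
elim: d j => [|d IH] j nE.
  apply: (@eqv_trans _ [:: (j, Cup); (j.+1, Cross false); (j.+1, Cross true)]).
    rewrite addn0 in nE; rewrite nE.
    apply: (@eqv_catr j.+3 _ [:: _; _] [:: _; _]); last by tangle_tac.
    by apply/eqv_sym/eqv_cross_cup => //; lia.
  apply: (@eqv_catl n.+2 n [:: _] _ [::]); first by tangle_tac.
  by apply: eqv_R2; lia.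
have -> : arc j d.+2 = arc j.+1 d.+1 ++ [:: (j, Cross true)] by [].
apply: (@eqv_trans _ ((arc j.+1 d.+1 ++ [:: (n, Cross true)]) ++ [:: (j, Cross true)])).
  rewrite -!(catA (arc j.+1 d.+1)).
  apply: (@eqv_catl n.+2); first by apply: tangle_arc; lia.
  by apply: eqv_far; tangle_tac.
apply: (@eqv_catr n.+2); last by tangle_tac.
by apply: IH; lia.
Qed.

Lemma eqv_arc_over_arc n l e j d :
  n = (l + e)%N -> n = (j + d)%N -> (l <= j)%N ->
  eqv n (arc l e ++ arc j.+1 d) (arc j d ++ arc l e.+2) n.+4.
Proof.
move=> nE; elim: d j => [|d IH] j nE' lj.
  by apply: (@eqv_slide_over n n.+4 l e e.+2 j Cup); rewrite //=; lia.
rewrite [arc j.+1 d.+1]/= [arc j d.+1]/=.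
apply: (@eqv_trans _ ((arc j.+1 d ++ arc l e.+2) ++ [:: (j.+1, Cross true)])).
  rewrite catA.
  by apply: (@eqv_catr n.+4); [apply: IH; lia | tangle_tac].
rewrite -!(catA (arc j.+1 d)).
apply: (@eqv_catl n.+2); first by apply: tangle_arc; lia.
by apply: (@eqv_slide_over n.+2 n.+4 l e.+2 e.+2 j (Cross true)); rewrite //=; lia.
Qed.

Lemma kills_descent n j m v : cross_stable n -> cap_stable n ->
  (j + m <= n)%N -> kills n.+2 v -> kills n.+2 (descent j m ++ v).
Proof.
move=> cn capn; elim: m j v => [|m IH] j v //= jm kv.
by rewrite -catA; apply: IH; [lia | apply: kills_cross_below => //; lia].
Qed.

Lemma kills_cross_right n v c : cross_stable n -> cap_stable n ->
  kills n.+2 v -> kills n.+2 ((n, Cross c) :: v).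
Proof.
move=> cn capn kv; have [Hv _] := kv.
apply: kills_cross => // j d nE.
case: d nE => [|d] nE.
  rewrite addn0 in nE; rewrite -nE; exists true;
    have [Ha az] := @kills_arc n n 0 v (esym (addn0 n)) kv.
  split=> [|b sb]; first by rewrite tangle_arc_cat ?addn0 //; tangle_by Hv.
  by apply: (curl_cup (n := n)) => //; [apply: standard_tangle | exact: az].
exists true; rewrite -cat1s catA.
apply: (kills_eqv (@eqv_arc_cross_right n j d _) Hv); first by lia.
case: n nE cn capn kv Hv => [|[|n]] nE cn capn kv Hv; first by lia.
  by apply: kills1; rewrite tangle_arc_cat //; lia.
apply: kills_arcs => l e nE'.
have Hjv : tangle n.+2 (arc j d ++ v) 0 by rewrite tangle_arc_cat //; lia.
case: (ltnP l j) => [lj|jl].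
  case: j nE lj Hjv => // j nE lj Hjv; rewrite catA.
  have E : eqv n (arc l e ++ arc j.+1 d) (arc j d ++ arc l e.+2) n.+4.
    by apply: eqv_arc_over_arc; lia.
  apply: (kills_eqv E Hv); rewrite -catA.
  by apply: kills_arc; [lia | apply: kills_arc => //; lia].
(* The arc [arc j d] first crosses the [e] strands at the right of the end [l] of
   the other arc, which it can do below that arc instead. *)
pose m := (l.+1 - j)%N.
have -> : d = (m + e)%N by lia.
rewrite arc_descent (_ : (j + m)%N = l.+1); last by lia.
rewrite -catA catA.
have E : eqv n (arc l e ++ arc l.+1 e) (arc l e ++ arc l e.+2) n.+4.
  by apply: eqv_arc_over_arc.
have kd : kills n.+4 (descent j m ++ v).
  by apply: kills_descent => //; lia.
apply: (kills_eqv E); first by have [] := kd.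
by rewrite -catA; apply: kills_arc => //; apply: kills_arc => //; lia.
Qed.

Lemma cross_stable_all n : cross_stable n /\ cap_stable n.
Proof.
elim/ltn_ind: n => -[|[|n]] IH.
- have c0 : cross_stable 0 by move=> k c v; rewrite ltn0.
  by split=> //; apply: cap_stable_step.
- have c1 : cross_stable 1 by move=> k c v.
  by split=> //; apply: cap_stable_step => // m [].
have [|cn capn] := IH n; first by [].
have cn2 : cross_stable n.+2.
  move=> k c v kn; case: (ltnP k n) => kn'; first exact: kills_cross_below.
  have -> : k = n by lia.
  exact: kills_cross_right.
by split=> //; apply: cap_stable_step => // m [<-].
Qed.

Theorem zero_on_tangles w : tangle 0 w 0 -> g w = 0.
Proof.
suff H n : tangle n w 0 -> kills n w.
  by move=> /H [_ /(_ _ standard_nil)].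
elim: w n => [|[k s] w IH] n /=.
  by move=> /eqP ->; split=> // b; move nE: 0%N => m sb; case: sb nE.
case/and3P=> vs kn /IH; rewrite /strands_above /=.
have [cn capn] := cross_stable_all n.
case: s vs kn => [||c|] //= _ kn.
- by rewrite subn0 addn2; apply: kills_cup; lia.
- have [m mE] : exists m, n = m.+2 by exists n.-2; lia.
  rewrite mE (_ : (m.+2 - 2 + 0)%N = m); last by lia.
  by apply: (cross_stable_all m).2; lia.
by rewrite subnK => [|]; [apply: cn|]; lia.
Qed.

End Uniqueness.

(** * The sum over orientations *)

Section Orientations.

Variables (K : fieldType) (A : K).

(* A sequence of booleans says which of the strands cut by a horizontal line are
   oriented upwards.  [act i x f y] is the sum of [f], with weights, over the
   orientations above the slice [(i, x)] compatible with [y] below it. *)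
Definition act0 (x : piece) (f : seq bool -> K) (y : seq bool) : K :=
  match x, y with
  | Cup, _ => f [:: true, false & y] + f [:: false, true & y]
  | Cap, [:: a, b & y'] => if a == b then 0 else f y'
  | Cross c, [:: a, b & y'] =>
      (if (a == b) == c then A else A^-1) * f [:: b, a & y']
  | Vertex, [:: a, b & y'] => if a == b then 0 else (- A - A^-1) * f y
  | _, _ => 0
  end.

Fixpoint act (i : nat) (x : piece) (f : seq bool -> K) (y : seq bool) : K :=
  match i, y with
  | 0%N, _ => act0 x f y
  | i'.+1, a :: y' => act i' x (fun t => f (a :: t)) y'
  | _, [::] => 0
  end.

Definition transfer (w : word) (f : seq bool -> K) : seq bool -> K :=
  foldr (fun s => act s.1 s.2) f w.

Definition orientation_sum (w : word) : K :=
  transfer w (fun y => (y == [::])%:R) [::].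

Lemma transfer_cat u v f : transfer (u ++ v) f = transfer u (transfer v f).
Proof. exact: foldr_cat. Qed.

Lemma act_eq i x f f' y : (i + ends_below x <= size y)%N ->
  (forall t, size t = strands_above (size y) (i, x) -> f t = f' t) ->
  act i x f y = act i x f' y.
Proof.
elim: i f f' y => [|i IH] f f' [|a y] //= le E.
- by case: x le E => [||c|] //= _ E; rewrite !E.
- by case: x y le E => [||c|] [|b y] //= le E; rewrite !E //=; tangle_tac.
by apply: IH => // t st; apply: E; rewrite /= st; move: le; case: x st => [||c|];
  tangle_tac.
Qed.

Lemma transfer_eq n u m f f' y : tangle n u m -> size y = n ->
  (forall t, size t = m -> f t = f' t) -> transfer u f y = transfer u f' y.
Proof.
elim: u n y => [|[i x] u IH] n y /=; first by move/eqP-> => sy; apply.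
case/and3P=> _ le Hu sy E; apply: act_eq => [|t st]; first by rewrite sy.
by apply: IH Hu _ E; rewrite st sy.
Qed.

Lemma orientation_sum_eq n u m l r v : tangle 0 u n -> tangle n l m ->
  (forall f y, size y = n -> transfer l f y = transfer r f y) ->
  orientation_sum (u ++ l ++ v) = orientation_sum (u ++ r ++ v).
Proof.
move=> Hu Hl E; rewrite /orientation_sum !transfer_cat.
by apply: transfer_eq Hu _ _ => // t st; apply: E.
Qed.

Lemma actD j x f g y :
  act j x (fun t => f t + g t) y = act j x f y + act j x g y.
Proof.
elim: j f g y => [|j IH] f g [|a y] //=; rewrite ?addr0 ?IH //.
  by case: x => //=; rewrite ?addr0 // addrACA.
by case: x y => [||c|] [|b y] //=; rewrite ?addr0 ?mulrDr //; try case: eqP => _;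
  rewrite ?addr0 ?mulrDr // addrACA.
Qed.

Lemma actZ j x c f y : act j x (fun t => c * f t) y = c * act j x f y.
Proof.
elim: j f y => [|j IH] f [|a y] //=; rewrite ?mulr0 ?IH //.
  by case: x => //=; rewrite ?mulr0 ?mulrDr.
by case: x y => [||d|] [|b y] //=; rewrite ?mulr0 ?mulrDr //; try case: eqP => _;
  rewrite ?mulr0 // mulrCA.
Qed.

Lemma act_0 j x y : act j x (fun=> 0) y = 0.
Proof.
elim: j y => [|j IH] [|a y] //=.
  by case: x => //=; rewrite addr0.
by case: x y => [||d|] [|b y] //=; rewrite ?mulr0 ?addr0 //; case: eqP.
Qed.

Lemma act_ext i x f f' y : f =1 f' -> act i x f y = act i x f' y.
Proof.
elim: i f f' y => [|i IH] f f' [|a y] //= E; last by apply: IH => t.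
  by case: x => //=; rewrite !E.
by case: x y => [||c|] [|b y] //=; rewrite !E.
Qed.

Lemma transferD w f g y :
  transfer w (fun t => f t + g t) y = transfer w f y + transfer w g y.
Proof.
by elim: w y => //= s w IH y; rewrite -actD; apply: act_ext.
Qed.

Lemma transferZ w c f y :
  transfer w (fun t => c * f t) y = c * transfer w f y.
Proof.
by elim: w y => //= s w IH y; rewrite -actZ; apply: act_ext.
Qed.

Lemma act_far i x j y f t : (i + ends_below x <= j)%N ->
  act i x (act (j - ends_below x + ends_above x) y f) t
  = act j y (act i x f) t.
Proof.
elim: i j f t => [|i IH] j f t le.
  case: x le => [||c|] /= le.
  - by rewrite subn0 addn2 actD.
  - case: j le => [|[|j]] // _; rewrite (_ : (j.+2 - 2 + 0)%N = j); last by lia.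
    by case: t => [|a [|b t]] //=; case: eqP => _; rewrite ?act_0.
  - case: j le => [|[|j]] // _; rewrite (_ : (j.+2 - 2 + 2)%N = j.+2); last by lia.
    by case: t => [|a [|b t]] //=; rewrite actZ.
  case: j le => [|[|j]] // _; rewrite (_ : (j.+2 - 2 + 2)%N = j.+2); last by lia.
  by case: t => [|a [|b t]] //=; case: eqP => _; rewrite ?act_0 ?actZ.
case: j le => [|j] le; first by lia.
have -> : (j.+1 - ends_below x + ends_above x = (j - ends_below x + ends_above x).+1)%N.
  by lia.
by case: t => [|a t] //=; apply: (IH j (fun t => f (a :: t))); lia.
Qed.

Lemma act_zigzag_l i f y : (i < size y)%N -> act i.+1 Cup (act i Cap f) y = f y.
Proof.
elim: i f y => [|i IH] f [|a y] //= le; last exact: (IH (fun t => f (a :: t))).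
by case: a; rewrite /= ?addr0 ?add0r.
Qed.

Lemma act_zigzag_r i f y : (i < size y)%N -> act i Cup (act i.+1 Cap f) y = f y.
Proof.
elim: i f y => [|i IH] f [|a y] //= le; last exact: (IH (fun t => f (a :: t))).
by case: a; rewrite /= ?addr0 ?add0r.
Qed.

Lemma act_cross_cup i b f y : (i < size y)%N ->
  act i Cup (act i.+1 (Cross b) f) y = act i.+1 Cup (act i (Cross (~~ b)) f) y.
Proof.
elim: i f y => [|i IH] f [|a y] //= le; last exact: (IH (fun t => f (a :: t))).
by case: a b => [] [].
Qed.

Lemma act_cross_cap i b f y : (i.+2 < size y)%N ->
  act i.+1 (Cross b) (act i Cap f) y = act i (Cross (~~ b)) (act i.+1 Cap f) y.
Proof.
elim: i f y => [|i IH] f [|a y] //= le; last exact: (IH (fun t => f (a :: t))).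
case: y le => [|b1 [|b2 y]] //= _.
by case: a b b1 b2 => [] [] [] [] /=; rewrite ?mulr0.
Qed.

Lemma act_R2 i b f y : A != 0 -> (i.+1 < size y)%N ->
  act i (Cross b) (act i (Cross (~~ b)) f) y = f y.
Proof.
move=> A_neq0; elim: i f y => [|i IH] f [|a y] //= le;
  last exact: (IH (fun t => f (a :: t))).
by case: y le => [|c y] //= _; case: a b c => [] [] [] /=;
  rewrite mulrA ?mulfV ?mulVf ?mul1r.
Qed.

Lemma act_R3 i b1 b2 b3 f y : (i.+2 < size y)%N -> (b2 == b1) || (b2 == b3) ->
  act i (Cross b1) (act i.+1 (Cross b2) (act i (Cross b3) f)) y
  = act i.+1 (Cross b3) (act i (Cross b2) (act i.+1 (Cross b1) f)) y.
Proof.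
move=> le b2E; elim: i f y le => [|i IH] f [|a y] //= le;
  last exact: (IH (fun t => f (a :: t))).
case: y le => [|b [|c y]] //= _.
by case: b1 b2 b3 b2E a b c => [] [] [] //= _ [] [] [] //=; ring.
Qed.

Lemma transfer_move l r n m m' f y : A != 0 -> move l r -> tangle n l m -> tangle n
  r m' ->
  size y = n -> transfer l f y = transfer r f y.
Proof.
move=> A_neq0; case=> [i j x t le|i|i|i b|i b|i b|i b1 b2 b3 bE] Hl Hr sy /=.
- exact: act_far.
- by apply: act_zigzag_l; rewrite sy; move: Hl; tangle_tac.
- by apply: act_zigzag_r; rewrite sy; move: Hl; tangle_tac.
- by apply: act_cross_cup; rewrite sy; move: Hl; tangle_tac.
- by apply: act_cross_cap; rewrite sy; move: Hl; tangle_tac.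
- by apply: act_R2 => //; rewrite sy; move: Hl; tangle_tac.
by apply: act_R3 => //; rewrite sy; move: Hl; tangle_tac.
Qed.

Lemma transfer_skein i b f y : (i.+1 < size y)%N ->
  act i (Cross b) f y - act i (Cross (~~ b)) f y
  = (A - A^-1) * (transfer (smoothing b i true) f y
                  - transfer (smoothing b i false) f y).
Proof.
elim: i f y => [|i IH] f [|a y] //= le; last first.
  by have := IH (fun t => f (a :: t)) y le; rewrite /smoothing; case: b {IH}.
case: y le => [|c y] // _; rewrite /smoothing.
by case: a b c => [] [] [] /=; ring.
Qed.

Lemma act_vertex i b f y : (i.+1 < size y)%N ->
  act i Vertex f y = act i (Cross b) f y - A * transfer (smoothing b i true) f y
                     - A^-1 * transfer (smoothing b i false) f y.
Proof.
elim: i f y => [|i IH] f [|a y] //= le; last first.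
  by have := IH (fun t => f (a :: t)) y le; rewrite /smoothing; case: b {IH}.
case: y le => [|c y] // _; rewrite /smoothing.
by case: a b c => [] [] [] /=; ring.
Qed.

Lemma transfer_curl_r b i f y : (i < size y)%N ->
  transfer (curl_r b i) f y = (if b then A else A^-1) * f y.
Proof.
elim: i f y => [|i IH] f [|a y] //= le; last exact: (IH (fun t => f (a :: t))).
by case: a b => [] []; rewrite /= ?mulr0 ?addr0 ?add0r.
Qed.

Lemma transfer_curl_l b i f y : (i < size y)%N ->
  transfer (curl_l b i) f y = (if b then A else A^-1) * f y.
Proof.
elim: i f y => [|i IH] f [|a y] //= le; last exact: (IH (fun t => f (a :: t))).
by case: a b => [] []; rewrite /= ?mulr0 ?addr0 ?add0r.
Qed.

End Orientations.

(** * Specialization of Laurent polynomials *)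

Section Specialization.

Variables (K : fieldType) (a z : K).

Definition eval_a : {poly int} -> K := horner_eval a \o map_poly intr.
HB.instance Definition _ := GRing.RMorphism.on eval_a.

Definition eval_az : {poly {poly int}} -> K := horner_eval z \o map_poly eval_a.
HB.instance Definition _ := GRing.RMorphism.on eval_az.

Lemma eval_az_a : eval_az ('X : {poly int})%:P = a.
Proof.
rewrite /eval_az /= map_polyC /horner_eval hornerC.
by rewrite /= /eval_a /= map_polyX /horner_eval hornerX.
Qed.

Lemma eval_az_z : eval_az 'X = z.
Proof. by rewrite /eval_az /= map_polyX /horner_eval hornerX. Qed.

End Specialization.

Lemma levalE (K : fieldType) (a z : K) f :
  leval a z f = eval_az a z f.1 / (a * z) ^+ f.2.
Proof. by []. Qed.

Lemma eval_az_generic p : eval_az var_a var_z p = tofrac p.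
Proof.
elim/poly_ind: p => [|p c IH]; first by rewrite !rmorph0.
rewrite !rmorphD !rmorphM /= IH eval_az_z; congr (_ + _).
elim/poly_ind: c => [|c k IHc]; first by rewrite !rmorph0.
rewrite !rmorphD !rmorphM /= IHc eval_az_a; congr (_ + _).
by rewrite -[k]intz !rmorph_int.
Qed.

Section Specialized.

Variables (K : fieldType) (a z : K).
Hypotheses (a_neq0 : a != 0) (z_neq0 : z != 0).

Let az : {poly {poly int}} := ('X : {poly int})%:P * 'X.

(* The graph of the partial map from rational functions to [K] that substitutes
   [a] and [z] in Laurent polynomials. *)
Definition specializes (x : {fraction {poly {poly int}}}) (y : K) : Prop :=
  exists p n, x = tofrac p / tofrac az ^+ n /\ y = eval_az a z p / (a * z) ^+ n.

Lemma eval_azM : eval_az a z az = a * z.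
Proof. by rewrite rmorphM /= eval_az_a eval_az_z. Qed.

Lemma az_neq0 : a * z != 0. Proof. by rewrite mulf_neq0. Qed.

Lemma tofrac_az_neq0 : tofrac az != 0.
Proof. by rewrite tofrac_eq0 mulf_neq0 ?polyX_eq0 // polyC_eq0 polyX_eq0. Qed.

Lemma specializes_leval f : specializes (lfrac f) (leval a z f).
Proof.
exists f.1, f.2; rewrite levalE; split=> //.
by rewrite /lfrac levalE eval_az_generic /var_a /var_z -rmorphM.
Qed.

Lemma specializes_inj x y y' : specializes x y -> specializes x y' -> y = y'.
Proof.
move=> [p [n [-> ->]]] [q [m [E ->]]].
have F k : tofrac az ^+ k != 0 by rewrite expf_neq0 ?tofrac_az_neq0.
have F' k : (a * z) ^+ k != 0 by rewrite expf_neq0 ?az_neq0.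
apply/eqP; rewrite eqr_div //; move/eqP: E; rewrite eqr_div //.
rewrite -!rmorphXn -!rmorphM /= tofrac_eq => /eqP /(congr1 (eval_az a z)).
by rewrite !rmorphM !rmorphXn /= eval_azM => ->.
Qed.

Lemma specializesD x y x' y' :
  specializes x y -> specializes x' y' -> specializes (x + x') (y + y').
Proof.
move=> [p [n [-> ->]]] [q [m [-> ->]]].
exists (p * az ^+ m + q * az ^+ n), (n + m)%N.
rewrite !addf_div ?expf_neq0 ?tofrac_az_neq0 ?az_neq0 // !exprD.
by rewrite !rmorphD !(rmorphM _ p, rmorphM _ q) !rmorphXn /= eval_azM.
Qed.

Lemma specializesM x y x' y' :
  specializes x y -> specializes x' y' -> specializes (x * x') (y * y').
Proof.
move=> [p [n [-> ->]]] [q [m [-> ->]]].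
by exists (p * q), (n + m)%N; rewrite !mulf_div !exprD !rmorphM.
Qed.

Lemma specializesN x y : specializes x y -> specializes (- x) (- y).
Proof. by move=> [p [n [-> ->]]]; exists (- p), n; rewrite !rmorphN !mulNr. Qed.

Lemma specializes1 : specializes 1 1.
Proof. by exists 1, 0%N; rewrite !rmorph1 !expr0 !divr1. Qed.

Lemma specializes_a : specializes var_a a.
Proof. by exists ('X%:P), 0%N; rewrite !expr0 !divr1 eval_az_a. Qed.

Lemma specializes_z : specializes var_z z.
Proof. by exists 'X, 0%N; rewrite !expr0 !divr1 eval_az_z. Qed.

Lemma specializes_aV : specializes var_a^-1 a^-1.
Proof.
exists 'X, 1%N; rewrite !expr1 eval_az_z rmorphM /= !invfM; split.
  by rewrite mulrCA mulfV ?mulr1 // tofrac_eq0 polyX_eq0.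
by rewrite mulrCA mulfV ?mulr1.
Qed.

End Specialized.

(** * The value of the Kauffman-Vogel polynomial *)

Section DubrovnikValue.

Variables (K : fieldType) (A : K).
Hypothesis A_neq0 : A != 0.

Local Notation osum := (orientation_sum A).

Lemma orientation_sum_move u v l r : move l r ->
  tangle 0 (u ++ l ++ v) 0 -> tangle 0 (u ++ r ++ v) 0 ->
  osum (u ++ l ++ v) = osum (u ++ r ++ v).
Proof.
move=> lr /tangle_catP[n Hu /tangle_catP[m Hl _]].
rewrite (tangle_cat _ _ Hu) => /tangle_catP[m' Hr _].
apply: (@orientation_sum_eq _ _ n _ m) => // h y sy;
  exact: (transfer_move _ A_neq0 lr Hl Hr sy).
Qed.

Lemma subr_eq_mulB (x y d p q : K) :
  (x - y == d * (p - q)) = (x + d * q == y + d * p).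
Proof. by rewrite -subr_eq0 -[RHS]subr_eq0; congr (_ == 0); ring. Qed.

Lemma orientation_sum_skein u v i b : tangle 0 (u ++ (i, Cross b) :: v) 0 ->
  osum (u ++ (i, Cross b) :: v) - osum (u ++ (i, Cross (~~ b)) :: v)
  = (A - A^-1) * (osum (u ++ smoothing b i true ++ v)
                  - osum (u ++ smoothing b i false ++ v)).
Proof.
case/tangle_catP=> n Hu /= /andP[le _].
rewrite /orientation_sum !transfer_cat /=; set h := transfer A v _.
apply/eqP; rewrite subr_eq_mulB -!transferZ -!transferD; apply/eqP.
apply: (transfer_eq _ Hu) => // t st; apply/eqP.
by rewrite -subr_eq_mulB transfer_skein // st; lia.
Qed.

Lemma orientation_sum_curl u v w c n : tangle 0 u n ->
  (forall h y, size y = n -> transfer A w h y = c * h y) ->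
  osum (u ++ w ++ v) = c * osum (u ++ v).
Proof.
move=> Hu E; rewrite /orientation_sum !transfer_cat -transferZ.
by apply: (transfer_eq _ Hu) => // t st; rewrite E.
Qed.

Variable f : word -> K.
Hypothesis z_neq0 : A - A^-1 != 0.
Hypothesis f_move : forall u v l r, move l r ->
  link_diagram (u ++ l ++ v) -> link_diagram (u ++ r ++ v) ->
  f (u ++ l ++ v) = f (u ++ r ++ v).
Hypothesis f_skein : forall u v i b, link_diagram (u ++ (i, Cross b) :: v) ->
  f (u ++ (i, Cross b) :: v) - f (u ++ (i, Cross (~~ b)) :: v)
  = (A - A^-1) * (f (u ++ smoothing b i true ++ v)
                  - f (u ++ smoothing b i false ++ v)).
Hypothesis f_curl_r : forall u v i b,
  link_diagram (u ++ v) -> link_diagram (u ++ curl_r b i ++ v) ->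
  f (u ++ curl_r b i ++ v) = (if b then A else A^-1) * f (u ++ v).
Hypothesis f_curl_l : forall u v i b,
  link_diagram (u ++ v) -> link_diagram (u ++ curl_l b i ++ v) ->
  f (u ++ curl_l b i ++ v) = (if b then A else A^-1) * f (u ++ v).
Hypothesis f_unknot : f [:: (0%N, Cup); (0%N, Cap)] = 1.

Lemma f_circle w : tangle 2 w 0 ->
  f [:: (0%N, Cup), (0%N, Cap), (0%N, Cup) & w] = 2%:R * f ((0%N, Cup) :: w).
Proof.
move=> Hw.
have L u : (0 < size u)%N -> tangle 0 u 2 -> link_diagram (u ++ w).
  by move=> su Hu; rewrite link_diagram_tangle size_cat addn_gt0 su (tangle_cat _ _ Hu).
pose cup i : slice := (i, Cup); pose cap i : slice := (i, Cap).
have far1 := @f_move [::] (cap 2 :: w) _ _ (@move_far 0 0 Cup Cup isT)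
  (L [:: cup 0; cup 2; cap 2] isT isT) (L [:: cup 0; cup 0; cap 2] isT isT).
have far2 := @f_move [:: cup 0] w _ _ (@move_far 0 0 Cup Cap isT)
  (L [:: cup 0; cup 0; cap 2] isT isT) (L [:: cup 0; cap 0; cup 0] isT isT).
have zig1 := @f_move [:: cup 0] [:: cup 1, cap 2 & w] _ _ (move_zigzag_l 1)
  (L [:: cup 0; cup 2; cap 1; cup 1; cap 2] isT isT) (L [:: cup 0; cup 1;
    cap 2] isT isT).
have zig2 := @f_move [:: cup 0] w _ _ (move_zigzag_r 1)
  (L [:: cup 0; cup 1; cap 2] isT isT) (L [:: cup 0] isT isT).
have curl b := @f_curl_r [:: cup 0] w 1 b
  (L [:: cup 0] isT isT) (L (cup 0 :: curl_r b 1) isT isT).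
have := @f_skein [:: cup 0; cup 2] (cap 2 :: w) 1 true
  (L [:: cup 0; cup 2; (1, Cross true); cap 2]%N isT isT).
move: (curl true) (curl false) far1 far2 zig1 zig2.
rewrite /smoothing /= -/(cup _) -/(cap _) => -> -> <- <- -> ->.
rewrite -mulrBl => /(mulfI z_neq0) /eqP.
by rewrite eq_sym subr_eq => /eqP ->; rewrite mulr2n mulrDl !mul1r.
Qed.

Lemma f_circled w : tangle 0 w 0 -> f [:: (0%N, Cup), (0%N, Cap) & w] = osum w.
Proof.
move=> Hw; apply/eqP; rewrite -subr_eq0; apply/eqP.
have L u : tangle 0 u 0 -> link_diagram [:: (0%N, Cup), (0%N, Cap) & u].
  by rewrite link_diagram_tangle.
pose g u := f [:: (0%N, Cup), (0%N, Cap) & u] - osum u.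
apply: (zero_on_tangles (g := g)) z_neq0 _ _ _ _ _ _ _ Hw; rewrite /g.
- move=> u v l r lr Hl Hr; congr (_ - _); last exact: orientation_sum_move.
  by apply: (f_move (u := [:: _, _ & u])) => //; apply: L.
- move=> u v i b H; have /= F := @f_skein [:: (0%N, Cup), (0%N, Cap) & u] v i b (L _ H).
  by rewrite opprD addrACA -opprD F orientation_sum_skein //; ring.
- move=> u v i b Huv H /eqP; rewrite subr_eq0 => /eqP E.
  have F : f [:: (0%N, Cup), (0%N, Cap) & u ++ curl_r b i ++ v] = _ :=
    @f_curl_r [:: _, _ & u] v i b (L _ Huv) (L _ H).
  rewrite {}F.
  have [n Hu Hc] := tangle_catP _ _ _ _ H.
  have lt : (i < n)%N by move: Hc; tangle_tac.
  rewrite (@orientation_sum_curl _ _ _ (if b then A else A^-1) n Hu) => [|h y sy].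
    by rewrite E subrr.
  by apply: transfer_curl_r; rewrite sy.
- move=> u v i b Huv H /eqP; rewrite subr_eq0 => /eqP E.
  have F : f [:: (0%N, Cup), (0%N, Cap) & u ++ curl_l b i ++ v] = _ :=
    @f_curl_l [:: _, _ & u] v i b (L _ Huv) (L _ H).
  rewrite {}F.
  have [n Hu Hc] := tangle_catP _ _ _ _ H.
  have lt : (i < n)%N by move: Hc; tangle_tac.
  rewrite (@orientation_sum_curl _ _ _ (if b then A else A^-1) n Hu) => [|h y sy].
    by rewrite E subrr.
  by apply: transfer_curl_l; rewrite sy.
- move=> v Hv /eqP; rewrite subr_eq0 => /eqP E.
  rewrite f_circle; last by rewrite /= /strands_above.
  rewrite E /orientation_sum /= -mulr2n mulr_natl; exact: subrr.
by rewrite f_unknot /orientation_sum /= subrr.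
Qed.

Lemma f_value w : link_diagram w -> 2%:R * f w = osum w.
Proof.
rewrite link_diagram_tangle => /andP[w0 Hw]; rewrite -f_circled //.
case: w => [//|[i x] w] in w0 Hw *; case/and3P: (Hw) => _ le.
have [-> ->] : i = 0%N /\ x = Cup.
  by case: x le {w0 Hw} => [||b|] /= le; [split=> // | | |]; lia.
by move=> Hw'; rewrite f_circle.
Qed.

End DubrovnikValue.

Lemma dubrovnik_value (D : word -> laurent) (K : fieldType) (A : K) w :
  is_dubrovnik D -> A != 0 -> A - A^-1 != 0 -> link_diagram w ->
  2%:R * leval A (A - A^-1) (D w) = orientation_sum A w.
Proof.
move=> HD A0 z0; have inj := specializes_inj A0 z0.
have spec w' : specializes A (A - A^-1) (lfrac (D w')) (leval A (A - A^-1) (D w')).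
  exact: specializes_leval.
have spec_curl (b : bool) : specializes A (A - A^-1) (if b then var_a else var_a^-1)
    (if b then A else A^-1).
  by case: b; [apply: specializes_a | apply: specializes_aV].
apply: (f_value (f := fun w' => leval A (A - A^-1) (D w')) A0 z0).
- move=> u v l r lr Hl Hr; apply: inj (spec _) _.
  by rewrite (dubrovnik_isotopy HD Hl Hr) //; apply: RI_move.
- move=> u v i b H; apply: inj (specializesD A0 z0 (spec _) (specializesN (spec _))) _.
  rewrite (dubrovnik_skein HD H).
  apply: specializesM; first exact: specializes_z.
  by apply: specializesD => //; apply: specializesN.
- move=> u v i b Huv H; apply: inj (spec _) _.
  by rewrite (dubrovnik_curl_r HD Huv H); apply: specializesM.
- move=> u v i b Huv H; apply: inj (spec _) _.
  by rewrite (dubrovnik_curl_l HD Huv H); apply: specializesM.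
by apply: inj (spec _) _; rewrite (dubrovnik_unknot HD); apply: specializes1.
Qed.

Lemma smoothing_tangle n b i t : (i.+1 < n)%N -> tangle n (smoothing b i t) n.
Proof. by rewrite /smoothing; case: eqP => _ lt; tangle_tac. Qed.

Lemma resolve_tangle n eps s w : well_formed n w -> tangle n (resolve eps s w) 0.
Proof.
elim: w n eps s => [|[i x] w IH] n eps s //=.
case: x => [||c|] /=; rewrite /strands_above /= => /andP[le Hw].
- by rewrite le IH.
- by rewrite le IH.
- by rewrite le IH.
have lt : (i.+1 < n)%N by lia.
have {}Hw : well_formed n w by rewrite subnK // in Hw; lia.
have Hp : tangle n (if head None s is Some t then smoothing (head true eps) i t
    else [:: (i, Cross (head true eps))]) n.
  by case: (head None s) => [t|]; [apply: smoothing_tangle | tangle_tac].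
by rewrite (tangle_cat _ _ Hp); apply: IH.
Qed.

Lemma resolve_link_diagram eps s w : diagram w -> link_diagram (resolve eps s w).
Proof.
case/andP; case: w => // [[i x] w] _ Hw;
  rewrite link_diagram_tangle resolve_tangle // andbT.
by case: x Hw => //= /andP[]; rewrite addn2.
Qed.

Lemma big_tuple_cons (V : nmodType) (T : finType) n (F : seq T -> V) :
  \sum_(s : n.+1.-tuple T) F s = \sum_(x : T) \sum_(s : n.-tuple T) F (x :: s).
Proof.
rewrite pair_big_dep /=.
rewrite (reindex (fun p : T * n.-tuple T => [tuple of p.1 :: p.2])) //=.
exists (fun s => (thead s, [tuple of behead s])) => [[x s] _|s _] /=.
  by rewrite theadE; congr (_, _); apply: val_inj.
by rewrite -tuple_eta.
Qed.

Section Expansion.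

Variables (K : fieldType) (A : K).

Lemma transfer_sum (I : Type) (r : seq I) (F : I -> seq bool -> K) w y :
  transfer A w (fun t => \sum_(j <- r) F j t) y
  = \sum_(j <- r) transfer A w (F j) y.
Proof.
elim: r y => [|j r IH] y.
  rewrite big_nil; elim: w y => [|[i x] w IHw] y /=; first by rewrite big_nil.
  by rewrite -[RHS](act_0 A i x y); apply: act_ext.
rewrite big_cons -IH -transferD.
by elim: w y {IH} => [|[i x] w IHw] y /=; [rewrite big_cons | apply: act_ext].
Qed.

Definition state_weight (s : seq (option bool)) : K :=
  (- A) ^+ count_mem (Some true) s * (- A^-1) ^+ count_mem (Some false) s.

Lemma kauffman_vogel_expansion n w eps f y : well_formed n w -> size y = n ->
  \sum_(s : (nb_vertices w).-tuple (option bool))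
     state_weight s * transfer A (resolve eps s w) f y
  = transfer A w f y.
Proof.
elim: w n eps y => [|[i x] w IH] n eps y Hw sy.
  rewrite (big_pred1 [tuple]) => [|s]; last exact/esym/eqP/tuple0.
  by rewrite /state_weight /= !expr0 !mul1r.
move: Hw => /= /andP[le Hw].
have step pre m : tangle n pre m -> well_formed m w -> forall eps',
    \sum_(s : (nb_vertices w).-tuple (option bool))
      state_weight s * transfer A (pre ++ resolve eps' s w) f y
    = transfer A pre (transfer A w f) y.
  move=> Hpre Hw' eps'; under eq_bigr => s _ do rewrite transfer_cat -transferZ.
  rewrite -transfer_sum; apply: (transfer_eq _ Hpre) => // t st.
  exact: IH st.
case: x le Hw step => [||c|] le Hw step.
- by apply: (step [:: (i, Cup)] _ _ Hw); rewrite /= /is_vertex /= eqxx andbT.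
- by apply: (step [:: (i, Cap)] _ _ Hw); rewrite /= /is_vertex /= eqxx andbT.
- by apply: (step [:: (i, Cross c)] _ _ Hw); rewrite /= /is_vertex /= eqxx andbT.
have {}le : (i.+1 < n)%N by rewrite /= in le; lia.
have {}Hw : well_formed n w by move: Hw; rewrite /strands_above /= subnK //; lia.
rewrite (big_tuple_cons _ (fun s => state_weight s * transfer A (resolve eps s ((i,
  Vertex) :: w)) f y)).
have weight o (s : seq (option bool)) : state_weight (o :: s)
    = (if o is Some t then - (if t then A else A^-1) else 1) * state_weight s.
  rewrite /state_weight; case: o => [[]|] /=; rewrite ?add0n ?add1n ?exprS ?mul1r //;
    ring.
under eq_bigr => o _ do under eq_bigr => s _ do rewrite weight -mulrA.
pose b := head true eps.
pose pre (o : option bool) := if o is Some t then smoothing b i t else [:: (i,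
  Cross b)].
have Hpre o : tangle n (pre o) n.
  by case: o => [t|]; [apply: smoothing_tangle | tangle_tac].
have inner o : \sum_(s : (nb_vertices w).-tuple (option bool))
    state_weight s * transfer A (resolve eps (o :: s) ((i, Vertex) :: w)) f y
    = transfer A (pre o) (transfer A w f) y.
  by rewrite -(step _ _ (Hpre o) Hw (behead eps)); apply: eq_bigr; case: o.
under eq_bigr => o _ do rewrite -mulr_sumr inner.
rewrite (bigD1 None) //= (bigD1 (Some true)) //= (bigD1 (Some false)) //=.
rewrite big_pred0 => [|[[]|]] //; rewrite (act_vertex A b) ?sy //.
by rewrite /pre /=; ring.
Qed.

End Expansion.

(** * Counting alternating orientations *)

Lemma card_constant_on_components (T : finType) (e : rel T) :
  connect_sym e ->
  #|[set f : {ffun T -> bool} | [forall x, forall y, e x y ==> (f x == f y)]]|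
  = (2 ^ n_comp e predT)%N.
Proof.
move=> sym_e; pose R := [set x | x \in roots e].
have -> : n_comp e predT = #|R|.
  by rewrite /n_comp_mem; apply: eq_card => x; rewrite !inE andbT.
rewrite -card_powerset -(card_in_imset (f := fun B : {set T} => [ffun x =>
  fingraph.root e x \in B])).
  apply: eq_card => f; rewrite inE; apply/forallP/imsetP => [Hf|[B _ ->] x]; last first.
    apply/forallP=> y; apply/implyP=> exy; rewrite !ffunE.
    by rewrite (fingraph.rootP sym_e (connect1 exy)).
  have f_connect x y : connect e x y -> f x = f y.
    case/connectP=> p; elim: p x => [|z p IH] x /= => [_ -> //|/andP[exz pzp] yE].
    by rewrite (eqP (implyP (forallP (Hf x) z) exz)); apply: IH.
  exists [set x in R | f x]; first by rewrite inE; apply/subsetP=> x;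
    rewrite inE => /andP[].
  apply/ffunP=> x; rewrite ffunE !inE roots_root //=.
  by rewrite -(f_connect _ _ (connect_root e x)).
move=> B C; rewrite !inE => sB sC /ffunP E; apply/setP=> x.
have := E x; rewrite !ffunE => {}E.
case Rx : (x \in R); last first.
  by rewrite (contraFF (subsetP sB x) Rx) (contraFF (subsetP sC x) Rx).
by move: Rx E; rewrite inE => /eqP ->.
Qed.

(* In the plane the strands at even and odd positions of a horizontal line can
   be given opposite orientations, and [twist] compares an orientation with that
   one: the relations imposed by cups, caps and vertices become equalities. *)
Fixpoint twist (b : bool) (y : seq bool) : seq bool :=
  if y is a :: y' then (a (+) b) :: twist (~~ b) y' else [::].

Definition succ0 (x : piece) (y : seq bool) : seq (seq bool) :=
  match x, y with
  | Cup, _ => [:: [:: true, true & y]; [:: false, false & y]]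
  | Cap, [:: a, b & y'] => if a == b then [:: y'] else [::]
  | Vertex, [:: a, b & y'] => if a == b then [:: y] else [::]
  | _, _ => [::]
  end.

Fixpoint succ (i : nat) (x : piece) (y : seq bool) : seq (seq bool) :=
  match i, y with
  | 0%N, _ => succ0 x y
  | i'.+1, a :: y' => [seq a :: t | t <- succ i' x y']
  | _, [::] => [::]
  end.

Fixpoint colorings (w : word) (y : seq bool) : seq (seq (seq bool)) :=
  if w is s :: w' then
    [seq t :: r | t <- succ s.1 s.2 y, r <- colorings w' t]
  else [:: [::]].

Lemma act_twist (K : fieldType) (A : K) i x f b y : ~~ is_cross (i, x) ->
  act A i x f (twist b y)
  = (- A - A^-1) ^+ is_vertex (i, x) * \sum_(t <- succ i x y) f (twist b t).
Proof.
elim: i b f y => [|i IH] b f [|a y] /= cx; rewrite ?big_nil ?mulr0 //.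
- case: x cx => [||?|] //= _; rewrite ?big_nil ?mulr0 // expr0 mul1r.
  by rewrite !big_cons big_nil addr0; case: b => //=; rewrite addrC.
- case: x y cx => [||?|] [|c y] //= _; rewrite ?big_nil ?mulr0 //=.
  + by rewrite expr0 mul1r !big_cons big_nil addr0; case: b => //=; rewrite addrC.
  + by rewrite expr0 mul1r !big_cons big_nil addr0; case: b => //=; rewrite addrC.
  + rewrite expr0 mul1r negbK; case: a b c => [] [] [] /=;
    rewrite ?big_nil // big_seq1 //.
  + by rewrite expr1; case: a b c => [] [] [] /=; rewrite ?big_nil ?mulr0 // big_seq1.
by rewrite IH // big_map.
Qed.

Lemma size_succ i x y t : t \in succ i x y -> (i + ends_below x <= size y)%N ->
  size t = strands_above (size y) (i, x).
Proof.
elim: i y t => [|i IH] [|a y] t //=.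
- by case: x => //=; rewrite !inE => /orP[] /eqP ->.
- case: x y => [||c|] [|b y] //=; rewrite /strands_above /= ?inE //.
  + by case/orP=> /eqP ->.
  + by case/orP=> /eqP ->; rewrite /= subn0 addn2.
  + by case: eqP => _; rewrite // inE => /eqP -> /=; lia.
  + by case: eqP => _; rewrite // inE => /eqP -> /=; lia.
case/mapP=> u Hu -> le /=; rewrite (IH _ _ Hu) //.
by move: le; case: x {IH Hu}; tangle_tac.
Qed.

Lemma transfer_twist (K : fieldType) (A : K) w y :
  planar w -> well_formed (size y) w ->
  transfer A w (fun t => (t == [::])%:R) (twist false y)
  = (- A - A^-1) ^+ nb_vertices w * (size (colorings w y))%:R.
Proof.
elim: w y => [|[i x] w IH] y /=; first by move=> _ /nilP ->; rewrite mulr1.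
move=> /andP[cx pw] /andP[le Hw].
rewrite act_twist // exprD -mulrA; congr (_ * _).
rewrite size_allpairs_dep sumnE big_map natr_sum mulr_sumr.
apply: eq_big_seq => t Ht; apply: IH => //.
by rewrite (size_succ Ht).
Qed.

Lemma uniq_succ i x y : uniq (succ i x y).
Proof.
elim: i y => [|i IH] [|a y] //=; first by case: x.
  by case: x y => [||c|] [|b y] //=; case: eqP.
by rewrite map_inj_uniq // => ? ? [].
Qed.

Lemma uniq_colorings w y : uniq (colorings w y).
Proof.
elim: w y => //= s w IH y; apply: allpairs_uniq_dep => //; first exact: uniq_succ.
by move=> [t r] [t' r'] _ _ /= [-> ->].
Qed.

Lemma mem_colorings w y r :
  reflect (size r = size w /\ forall k, (k < size w)%N ->
      let s := nth (0%N, Cup) w k in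
      nth [::] r k \in succ s.1 s.2 (nth [::] (y :: r) k))
    (r \in colorings w y).
Proof.
elim: w y r => [|s w IH] y r /=.
  by rewrite inE; apply: (iffP eqP) => [->|[/size0nil]].
apply: (iffP allpairsPdep) => [[t [r' [Ht Hr' ->]]]|[]].
  have [sr H] := IH t r' Hr'; split=> [|[|k] lt] /=; rewrite ?sr //.
  exact: H.
case: r => [//|t r] [sr] H; exists t, r; split=> //; first exact: (H 0%N).
by apply/IH; split=> // k lt; apply: (H k.+1).
Qed.

Lemma linkedSS i x b p c q :
  linked (i.+1, x) (b, p.+1) (c, q.+1) = linked (i, x) (b, p) (c, q).
Proof.
by case: x => [||d|]; case: b; case: c; rewrite /linked /= ?inE ?xpair_eqE /=; lia.
Qed.

Lemma linkedS0 i x b c q :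
  linked (i.+1, x) (b, 0%N) (c, q) = [&& ~~ b, c & q == 0%N].
Proof.
by case: x => [||d|]; case: b; case: c; rewrite /linked /= ?inE ?xpair_eqE /=; lia.
Qed.

Lemma linkedS_0 i x b p c :
  linked (i.+1, x) (b, p) (c, 0%N) = [&& ~~ b, c & p == 0%N].
Proof.
by case: x => [||d|]; case: b; case: c; rewrite /linked /= ?inE ?xpair_eqE /=; lia.
Qed.

Definition compatible (s : slice) (y t : seq bool) : Prop :=
  forall b p c q,
    (p < size (if b then t else y))%N -> (q < size (if c then t else y))%N ->
    linked s (b, p) (c, q) ->
    nth false (if b then t else y) p = nth false (if c then t else y) q.

Lemma compatibleS i x a y t :
  compatible (i.+1, x) (a :: y) (a :: t) <-> compatible (i, x) y t.
Proof.
split=> H b p c q.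
  have := H b p.+1 c q.+1; rewrite linkedSS.
  by case: b c => [] [] /=; rewrite ?ltnS.
case: p => [|p].
  rewrite linkedS0 => _ _ /and3P[/negbTE -> -> /eqP ->] //.
case: q => [|q].
  by rewrite linkedS_0 => _ _ /and3P[/negbTE -> ->].
rewrite linkedSS; have := H b p c q.
by case: b c => [] [] /=; rewrite ?ltnS.
Qed.

Lemma mem_succ0 x y t : ~~ is_cross (0%N, x) -> (ends_below x <= size y)%N ->
  t \in succ 0 x y <-> size t = strands_above (size y) (0%N, x) /\ compatible (0%N,
    x) y t.
Proof.
move=> cx le; split=> [Ht|[]].
  split; first exact: size_succ Ht le.
  case: x cx le Ht => [||?|] //= _ le Ht b p c q.
  - have {Ht} [a ->] : exists a, t = [:: a, a & y].
      by move: Ht; rewrite !inE => /orP[] /eqP ->; [exists true | exists false].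
    rewrite /linked /= !inE !xpair_eqE; case: b; case: c => /= lp lq E;
      try by exfalso; lia.
      have : (p < 2)%N && (q < 2)%N by lia.
      by case: p q {lp lq E} => [|[|p]] [|[|q]].
    by have -> : q = p.+2 by lia.
  - case: y le Ht => [|a [|a' y]] //= _; case: eqP => // <-; rewrite inE => /eqP ->.
    rewrite /linked /= !inE !xpair_eqE; case: b; case: c => /= lp lq E;
      try by exfalso; lia.
      by have -> : p = q.+2 by lia.
    have : (p < 2)%N && (q < 2)%N by lia.
    by case: p q {lp lq E} => [|[|p]] [|[|q]].
  case: y le Ht => [|a [|a' y]] //= _; case: eqP => // <-; rewrite inE => /eqP ->.
  rewrite /linked /= !inE !xpair_eqE !if_same => lp lq E.
  have : ((p < 2)%N && (q < 2)%N) || (p == q) by move: E; case: b; case: c => /=; lia.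
  by case: eqP => [->//|_]; rewrite orbF; case: p q {lp lq E} => [|[|p]] [|[|q]].
rewrite /strands_above; case: x cx le => [||?|] //= _ le st C.
- case: t st C => [|a [|b t]] /=; try lia.
  rewrite subn0 addn2 => -[st] C.
  have ab : a = b by apply: (C true 0%N true 1%N).
  have -> : t = y.
    apply: (@eq_from_nth _ false) => // p lt; apply/esym.
    apply: (C false p true p.+2) => //; first by rewrite -st.
    by rewrite /linked /= ?inE ?xpair_eqE /=; lia.
  by rewrite -ab !inE; case: a {C ab}; rewrite eqxx ?orbT.
- case: y le st C => [|a [|b y]] //= _ st C.
  have ab : a = b by apply: (C false 0%N false 1%N).
  rewrite ab eqxx inE; apply/eqP/(@eq_from_nth _ false) => [|p lt]; first by lia.
  have py : (p < size y)%N by lia.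
  by apply/esym/(C false p.+2 true p py lt); rewrite /linked /=; lia.
case: y le st C => [|a [|b y]] //= _; case: t => [|a' [|b' t]] /=; try lia.
move=> st C; have ab : a = b by apply: (C false 0%N false 1%N).
have aa : a = a' by apply: (C false 0%N true 0%N).
have bb : b = b' by apply: (C false 1%N true 1%N).
rewrite -aa -bb ab eqxx inE.
apply/eqP; congr [:: _, _ & _]; apply: (@eq_from_nth _ false) => [|p lt]; first by lia.
have py : (p < size y)%N by lia.
apply/esym/(C false p.+2 true p.+2 py lt).
by rewrite /linked /= ?inE ?xpair_eqE /=; lia.
Qed.

Lemma mem_succ i x y t : ~~ is_cross (i, x) -> (i + ends_below x <= size y)%N ->
  t \in succ i x y <-> size t = strands_above (size y) (i, x) /\ compatible (i, x) y t.
Proof.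
elim: i y t => [|i IH] y t; first exact: mem_succ0.
case: y => [|a y]; first by case: x {IH}.
move=> cx le; split=> [/mapP[u Hu ->]|[]].
  have [] := (IH y u cx le).1 Hu => su /compatibleS Cu; split; last exact: Cu.
  by rewrite /= su; move: le; case: x {IH Hu cx Cu su}; tangle_tac.
case: t => [|b t]; first by move: le; case: x {IH cx}; tangle_tac.
move=> st C; have ab : a = b by apply: (C false 0%N true 0%N); rewrite //= linkedS0.
rewrite -ab in C *; apply/mapP; exists t => //; apply/(IH y t cx le); split.
  by move: st le; case: x {IH cx C} => [||?|]; tangle_tac.
by move/compatibleS: C.
Qed.

Lemma widthS w k : (k < size w)%N ->
  width w k.+1 = strands_above (width w k) (nth (0%N, Cup) w k).
Proof. by move=> lt; rewrite /width (take_nth (0%N, Cup)) // foldl_rcons. Qed.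

Lemma well_formed_nth n w k : well_formed n w -> (k < size w)%N ->
  let s := nth (0%N, Cup) w k in
  (s.1 + ends_below s.2 <= foldl strands_above n (take k w))%N.
Proof.
elim: w n k => [|s w IH] n [|k] //= /andP[le Hw] // lt.
exact: (IH _ k Hw lt).
Qed.

Section Colorings.

Variable w : word.
Hypotheses (planar_w : planar w) (wf_w : well_formed 0 w).

Implicit Type f : {ffun point w -> bool}.

Definition value f (k p : nat) : bool :=
  if insub k is Some k' then
    if insub p is Some p' then f (@Tagged 'I_(size w).+1 k' (fun k => 'I_(width w
      k)) p')
    else false
  else false.

Lemma valueE f (x : point w) : value f (tag x) (tagged x) = f x.
Proof. by case: x => k p; rewrite /value /= !valK. Qed.

Lemma point_at k p : (k <= size w)%N -> (p < width w k)%N ->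
  exists x : point w, tag x = k :> nat /\ tagged x = p :> nat.
Proof.
move=> kw pk; pose k' : 'I_(size w).+1 := Ordinal (kw : (k < (size w).+1)%N).
by exists (@Tagged _ k' (fun k => 'I_(width w k)) (Ordinal pk)).
Qed.

Definition row f k := mkseq (value f k) (width w k).

Definition rows f := mkseq (fun k => row f k.+1) (size w).

Lemma nth_rows f k : (k <= size w)%N -> nth [::] ([::] :: rows f) k = row f k.
Proof.
case: k => [|k] lt /=; first by rewrite /row /width take0.
by rewrite nth_mkseq.
Qed.

Definition respects f :=
  [forall x, forall y, @adjacent w x y ==> (f x == f y)].

Lemma respectsP f : respects f <->
  forall k, (k < size w)%N ->
    compatible (nth (0%N, Cup) w k) (row f k) (row f k.+1).
Proof.
split=> [Rf k lt b p c q|H].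
  have ifE (d : bool) : (if d then row f k.+1 else row f k) = row f (k + d).
    by case: d; rewrite ?addn1 ?addn0.
  rewrite !ifE !size_mkseq => lp lq link; rewrite !nth_mkseq //.
  have kd (d : bool) : (k + d <= size w)%N by case: d; lia.
  have [x [xk xp]] := point_at (kd b) lp; have [y [yk yq]] := point_at (kd c) lq.
  rewrite -xk -xp -yk -yq !valueE; apply/eqP.
  apply: (implyP (forallP (forallP Rf x) y)); apply/orP; left.
  apply/existsP; exists (Ordinal lt); apply/existsP; exists b; apply/existsP; exists c.
  by apply/and3P; split; [apply/eqP | apply/eqP | rewrite xp yq].
have {}H x y : directly_connected x y -> f x = f y.
  case/existsP=> k /existsP[b /existsP[c /and3P[/eqP xk /eqP yk link]]].
  have ifE (d : bool) : (if d then row f k.+1 else row f k) = row f (k + d).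
    by case: d; rewrite ?addn1 ?addn0.
  have := H k (ltn_ord k) b (tagged x) c (tagged y); rewrite !ifE !size_mkseq -xk -yk.
  by rewrite !nth_mkseq ?valueE //; apply; rewrite ?ltn_ord.
apply/forallP=> x; apply/forallP=> y; apply/implyP=> /orP[] /H -> //.
Qed.

Lemma rows_colorings f : rows f \in colorings w [::] <-> respects f.
Proof.
have /(all_nthP (0%N, Cup)) pw : all (fun s => ~~ is_cross s) w := planar_w.
have piece_at k : (k < size w)%N -> let s := nth (0%N, Cup) w k in
    row f k.+1 \in succ s.1 s.2 (row f k) <-> compatible s (row f k) (row f k.+1).
  move=> lt; move: (pw k lt) (well_formed_nth wf_w lt) (widthS lt).
  case: (nth _ w k) => i x cs le wS.
  have M := @mem_succ i x (row f k) (row f k.+1) cs.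
  rewrite !size_mkseq in M; split=> [/(M le).1[]//|C].
  exact: (M le).2.
rewrite respectsP; split=> [/mem_colorings[_ H] k lt|H].
  by apply/(piece_at k lt); have := H k lt; cbv zeta;
    rewrite nth_rows 1?ltnW // /rows nth_mkseq.
apply/mem_colorings; split=> [|k lt]; first by rewrite size_mkseq.
cbv zeta; rewrite nth_rows 1?ltnW // /rows nth_mkseq //.
by apply/(piece_at k lt)/H.
Qed.

Lemma rows_inj : injective rows.
Proof.
move=> f f' E; apply/ffunP=> x; rewrite -!valueE.
have kw : (tag x <= size w)%N by rewrite -ltnS.
have := congr1 (fun r => nth false (nth [::] ([::] :: r) (tag x)) (tagged x)) E.
by rewrite !nth_rows // !nth_mkseq.
Qed.

Lemma colorings_rows r : r \in colorings w [::] -> exists f, r = rows f.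
Proof.
case/mem_colorings=> sr H.
have Hs k : (k <= size w)%N -> size (nth [::] ([::] :: r) k) = width w k.
  elim: k => [|k IH] lt; first by rewrite /width take0.
  move: (H k lt) (well_formed_nth wf_w lt) (widthS lt).
  case: (nth (0%N, Cup) w k) => i x; cbv zeta => Ht le ->.
  have St := size_succ Ht; rewrite (IH (ltnW lt)) in St.
  exact: St le.
exists [ffun x : point w => nth false (nth [::] ([::] :: r) (tag x)) (tagged x)].
apply: (@eq_from_nth _ [::]) => [|k]; rewrite ?size_mkseq // sr => lt.
rewrite nth_mkseq //; apply: (@eq_from_nth _ false) => [|p].
  by rewrite size_mkseq -Hs.
rewrite (Hs k.+1 lt) => lp; rewrite nth_mkseq //.
have [x [xk xp]] := point_at (lt : (k.+1 <= size w)%N) lp.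
by rewrite -xk -xp valueE ffunE xp xk.
Qed.

Lemma size_colorings : size (colorings w [::]) = (2 ^ nb_components w)%N.
Proof.
rewrite /nb_components -card_constant_on_components; last first.
  by apply: sym_connect_sym => x y; rewrite /adjacent orbC.
rewrite cardE -(size_map rows); apply/perm_size/uniq_perm.
- exact: uniq_colorings.
- by rewrite (map_inj_uniq rows_inj) enum_uniq.
move=> r; apply/idP/mapP=> [Hr|[f]].
  have [f rE] := colorings_rows Hr; exists f => //.
  by rewrite mem_enum inE; apply/rows_colorings; rewrite -rE.
by rewrite mem_enum inE => Hf ->; apply/rows_colorings.
Qed.

End Colorings.

Lemma nb_components_gt0 w : diagram w -> (0 < nb_components w)%N.
Proof.
case/andP=> w0 wf_w.
have w1 : (0 < width w 1)%N.
  case: w w0 wf_w => // [[i x] w] _ /= /andP[le _]; rewrite /width /= take0 /=.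
  by case: x le; tangle_tac.
have [x _] := point_at w0 w1; rewrite /nb_components /n_comp_mem.
apply/card_gt0P; exists (fingraph.root (@adjacent w) x); rewrite !inE andbT.
by apply: roots_root; apply: sym_connect_sym => y z; rewrite /adjacent orbC.
Qed.

Theorem kauffman_vogel_planar (D : word -> laurent) (K : fieldType) (A : K) G
    (eps : (nb_vertices G).-tuple bool) :
  is_dubrovnik D -> A != 0 -> A - A^-1 != 0 -> 2%:R != 0 :> K ->
  diagram G -> planar G ->
  kauffman_vogel D eps A A A^-1
  = 2%:R ^+ (nb_components G).-1 * (- A - A^-1) ^+ nb_vertices G.
Proof.
move=> HD A0 z0 two0 dG pG; have wf_G : well_formed 0 G by case/andP: dG.
apply: (mulfI two0); rewrite mulrA -exprS prednK ?nb_components_gt0 //.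
rewrite -natrX -size_colorings // [RHS]mulrC -transfer_twist //.
rewrite -(kauffman_vogel_expansion A eps _ wf_G) // /kauffman_vogel mulr_sumr.
apply: eq_bigr => s _; rewrite mulrCA (dubrovnik_value HD) //.
exact: resolve_link_diagram.
Qed.

Lemma subr_inv_neq0 (K : fieldType) (A : K) :
  A != 0 -> A ^+ 2 != 1 -> A - A^-1 != 0.
Proof.
move=> A0; apply: contra; rewrite subr_eq0 => /eqP E.
by rewrite expr2 {1}E mulVf.
Qed.

Lemma tofrac_X_neq0 : tofrac ('X : {poly int}) != 0.
Proof. by rewrite tofrac_eq0 polyX_eq0. Qed.

Lemma tofrac_X2_neq1 : tofrac ('X : {poly int}) ^+ 2 != 1.
Proof.
rewrite -tofracXn -tofrac1 tofrac_eq; apply/eqP=> E.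
by have := size_polyXn int 2; rewrite E size_poly1.
Qed.

Lemma fraction_two_neq0 : 2%:R != 0 :> {fraction {poly int}}.
Proof.
by rewrite -tofrac1 -tofracMn tofrac_eq0 -polyC1 -polyCMn polyC_eq0.
Qed.

Theorem theorem4 (D : word -> laurent) (HD : is_dubrovnik D)
    (G : word) (G_diagram : diagram G) (G_planar : planar G)
    (eps : (nb_vertices G).-tuple bool) :
  let A : {fraction {poly int}} := tofrac ('X : {poly int}) in
  kauffman_vogel D eps A A A^-1
    = 2%:R ^+ (nb_components G).-1 * (- A - A^-1) ^+ nb_vertices G.
Proof.
move=> A; apply: (kauffman_vogel_planar eps HD _ _ _ G_diagram G_planar).
- exact: tofrac_X_neq0.
- exact: subr_inv_neq0 tofrac_X_neq0 tofrac_X2_neq1.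
- exact: fraction_two_neq0.
Qed.
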